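(* Let $(M,g,(J_\alpha)\in Q)$ be a $4n$-dimensional ($n>1$) quaternionic manifold with $Q$-hermitian metric $g$. Define, for $\alpha=1,2,3$, the 1-forms $$K_{\alpha}= \frac{1}{1-n}\left(J_{\beta}\theta_{\alpha} + \theta_{\alpha,\gamma}\right).$$ Then $M$ admits a QKT structure (that is, $(M,g,Q)$ is a QKT manifold) if and only if the following conditions hold (for every cyclic permutation $(\alpha,\beta,\gamma)$ of $(1,2,3)$): $$(d_{\alpha}F_{\alpha})^+- (d_{\beta}F_{\beta})^+ =\frac{1}{2}\left( K_{\alpha}\wedge F_{\beta}- J_{\beta}K_{\beta}\wedge F_{\alpha}-(K_{\beta}-J_{\alpha}K_{\alpha})\wedge F_{\gamma}\right),$$ where $(d_{\alpha}F_{\alpha})^+$ denotes the $(1,2)+(2,1)$-part of $d_{\alpha}F_{\alpha}$ with respect to $J_{\alpha}$. In this case the metric quaternionic connection $\nabla$ with torsion 3-form of type $(1,2)+(2,1)$ is unique and is determined by $$\nabla =\nabla^g +\frac{1}{2}\left((d_{\alpha}F_{\alpha})^+ -\frac{1}{2}\left(J_{\alpha}K_{\alpha}\wedge F_{\gamma}+K_{\alpha}\wedge F_{\beta}\right)\right),$$ where $\nabla^g$ is the Levi-Civita connection of $g$ (here $\nabla=\nabla^g+\frac12 T$ for a 3-form $T$ means $g(\nabla_XY,Z)=g(\nabla^g_XY,Z)+\frac12T(X,Y,Z)$).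
   Context: An almost quaternionic structure on a $4n$-dimensional manifold $M$ is a rank-3 subbundle $Q\subset \mathrm{End}(TM)$ locally spanned by triples $(J_1,J_2,J_3)$ of almost complex structures with $J_\alpha^2=-\mathrm{id}$, $J_1J_2=-J_2J_1=J_3$; such a (locally defined) triple is an admissible basis of $Q$. A linear connection is quaternionic if it preserves $Q$; $(M,Q)$ is a quaternionic manifold if there is a torsion-free quaternionic connection. A Riemannian metric $g$ is $Q$-hermitian if it is Hermitian with respect to each almost complex structure in $Q$. Throughout $(\alpha,\beta,\gamma)$ is a cyclic permutation of $(1,2,3)$, and expressions in $J_\alpha$ refer to an admissible basis, so they are local. For a connection $\nabla$, $T(X,Y)=\nabla_XY-\nabla_YX-[X,Y]$ and $T(X,Y,Z)=g(T(X,Y),Z)$. $(M,g,Q)$ is a QKT manifold if it admits a metric quaternionic connection $\nabla$ (a QKT-connection) whose torsion is totally skew-symmetric and is of type $(1,2)+(2,1)$ with respect to each $J_\alpha$, i.e. $T(X,Y,Z)=T(J_\alpha X,J_\alpha Y,Z)+T(J_\alpha X,Y,J_\alpha Z)+T(X,J_\alpha Y,J_\alpha Z)$. Notation: for an $r$-form $\psi$, $(J_\alpha\psi)(X_1,\dots,X_r)=(-1)^r\psi(J_\alpha X_1,\dots,J_\alpha X_r)$. $F_\alpha(X,Y)=g(X,J_\alpha Y)$ are the K\''ahler forms; $d_\alpha F_\beta(X,Y,Z)=-dF_\beta(J_\alpha X,J_\alpha Y,J_\alpha Z)$; $dF_\alpha^+$ is the $(1,2)+(2,1)$-part of $dF_\alpha$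 with respect to $J_\alpha$. The Lee forms are $\theta_\alpha=\delta F_\alpha\circ J_\alpha$, and $\theta_{\alpha,\beta}(X)=-\frac12\sum_{i=1}^{4n}dF_\alpha^+(X,e_i,J_\beta e_i)$ for $\alpha,\beta\in\{1,2,3\}$, where $(e_i)$ is an orthonormal basis (so $\theta_{\alpha,\alpha}=\theta_\alpha$). For a 1-form $\psi$ and a 2-form $F$, $(\psi\wedge F)(X,Y,Z)=\psi(X)F(Y,Z)+\psi(Y)F(Z,X)+\psi(Z)F(X,Y)$. *)

(* Defs.v *)
From HB Require Import structures.
From mathcomp Require Import all_boot all_order all_algebra.
From mathcomp Require Import all_classical all_reals all_analysis.
From mathcomp Require Import ring.

Set Implicit Arguments.
Unset Strict Implicit.
Unset Printing Implicit Defensive.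

Import Order.TTheory GRing.Theory Num.Theory.
Import numFieldNormedType.Exports.

Local Open Scope classical_set_scope.
Local Open Scope ring_scope.

(* Smooth maps on an open subset of a (finite-dimensional) normed space. *)

Fixpoint Ck (R : realType) (E W : normedModType R) (k : nat) (U : set E)
    (f : E -> W) : Prop :=
  match k with
  | 0 => forall x, U x -> {for x, continuous f}
  | k'.+1 => (forall x, U x -> differentiable f x) /\
             (forall v, Ck k' U (fun x => 'D_v f x))
  end.

Definition smooth_on (R : realType) (E W : normedModType R) (U : set E)
    (f : E -> W) : Prop := forall k, Ck k U f.

(* Manifolds. [bwd] is only meaningful on the open set [fwd @` dom]. *)

Record chart (R : realType) (m : nat) (T : topologicalType) := Chart {
  dom : set T;
  fwd : T -> 'cV[R]_m;
  bwd : 'cV[R]_m -> T;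
  dom_open : open dom;
  img_open : open (fwd @` dom);
  fwdK : forall p, dom p -> bwd (fwd p) = p;
  fwd_continuous : forall p, dom p -> {for p, continuous fwd};
  bwd_continuous : forall x, (fwd @` dom) x -> {for x, continuous bwd} }.

Record manifold (R : realType) (m : nat) := Manifold {
  carrier :> topologicalType;
  hausdorff_carrier : hausdorff_space carrier;
  second_countable_carrier : @second_countable carrier;
  atlas : set (chart R m carrier);
  chart_at : carrier -> chart R m carrier;
  chart_at_atlas : forall p, atlas (chart_at p);
  chart_at_dom : forall p, dom (chart_at p) p;
  atlas_compatible : forall c c', atlas c -> atlas c' ->
    smooth_on (fwd c @` (dom c `&` dom c')) (fwd c' \o bwd c) }.

(* The tangent space at [p] is identified with 'cV[R]_m through the differential
   of the preferred chart [chart_at p].  Vector fields, endomorphism fields and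
   tensors are therefore functions of [p] with values in (tensors on) 'cV[R]_m;
   an endomorphism [A] acts by [A *m v], so composition is [*m].  Such functions
   need not be continuous in [p] even when the corresponding section is smooth,
   because [chart_at] jumps: smoothness is always tested in charts. *)

Section Calculus.
Variables (R : realType) (m : nat) (M : manifold R m).
Local Notation V := ('cV[R]_m).

(* Differential at [q] of the transition map from [c] to [c']. *)
Definition tchange (c c' : chart R m M) (q : M) (v : V) : V :=
  'D_v (fwd c' \o bwd c) (fwd c q).

(* Components of the vector field [X] in the chart [c]. *)
Definition field_in (c : chart R m M) (X : M -> V) (q : M) : V :=
  tchange (chart_at q) c q (X q).

(* The vector field, defined on the domain of [chart_at p], whose components in
   that chart are constantly [u]. *)
Definition coord_field (p : M) (u : V) (q : M) : V :=
  tchange (chart_at p) (chart_at q) q u.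

Definition smooth_fun (U : set M) (f : M -> R^o) : Prop :=
  forall c, atlas c -> smooth_on (fwd c @` (dom c `&` U)) (f \o bwd c).

Definition smooth_field (U : set M) (X : M -> V) : Prop :=
  forall c, atlas c -> smooth_on (fwd c @` (dom c `&` U)) (field_in c X \o bwd c).

Definition smooth_endo (U : set M) (A : M -> 'M[R]_m) : Prop :=
  forall (W : set M) (X : M -> V), open W -> W `<=` U ->
    smooth_field W X -> smooth_field W (fun q => A q *m X q).

(* Derivative of [f] along the tangent vector [v] at [p]. *)
Definition vder (W : normedModType R) (p : M) (v : V) (f : M -> W) : W :=
  'D_v (f \o bwd (chart_at p)) (fwd (chart_at p) p).

Definition lie (X Y : M -> V) (p : M) : V :=
  vder p (X p) (field_in (chart_at p) Y) - vder p (Y p) (field_in (chart_at p) X).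

Record metric := Metric {
  metric_fun :> M -> V -> V -> R;
  metric_linear : forall p (a : R) u v w,
    metric_fun p (a *: u + v) w = a * metric_fun p u w + metric_fun p v w;
  metric_sym : forall p u v, metric_fun p u v = metric_fun p v u;
  metric_pos : forall p u, u != 0 -> 0 < metric_fun p u u;
  metric_smooth : forall (U : set M) X Y, open U ->
    smooth_field U X -> smooth_field U Y ->
    smooth_fun U (fun q => metric_fun q (X q) (Y q)) }.

(* A linear connection, as an operator on local sections of the tangent bundle:
   [D p v Y] is the covariant derivative at [p] of [Y] in the direction [v], for
   [Y] smooth near [p].  Its value for other [Y] is irrelevant. *)
Record connection := Connection {
  cov :> M -> V -> (M -> V) -> V;
  cov_local : forall (U : set M) X Y p v, open U -> U p -> smooth_field U X ->
    (forall q, U q -> X q = Y q) -> cov p v X = cov p v Y;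
  cov_linear : forall (U : set M) X p (a : R) u v, open U -> U p ->
    smooth_field U X -> cov p (a *: u + v) X = a *: cov p u X + cov p v X;
  cov_add : forall (U : set M) X Y p v, open U -> U p ->
    smooth_field U X -> smooth_field U Y ->
    cov p v (fun q => X q + Y q) = cov p v X + cov p v Y;
  cov_leibniz : forall (U : set M) (f : M -> R^o) X p v, open U -> U p ->
    smooth_fun U f -> smooth_field U X ->
    cov p v (fun q => f q *: X q) = f p *: cov p v X + vder p v f *: X p;
  cov_smooth : forall (U : set M) X Y, open U ->
    smooth_field U X -> smooth_field U Y ->
    smooth_field U (fun q => cov q (X q) Y) }.

Definition connection_eq (D D' : connection) : Prop :=
  forall (U : set M) Y p v, open U -> U p -> smooth_field U Y ->
    D p v Y = D' p v Y.

Definition torsion (D : connection) (X Y : M -> V) (p : M) : V :=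
  D p (X p) Y - D p (Y p) X - lie X Y p.

Definition torsion_free (D : connection) : Prop :=
  forall (U : set M) X Y p, open U -> U p ->
    smooth_field U X -> smooth_field U Y -> torsion D X Y p = 0.

Definition metric_connection (g : metric) (D : connection) : Prop :=
  forall (U : set M) X Y p v, open U -> U p ->
    smooth_field U X -> smooth_field U Y ->
    vder p v (fun q => g q (X q) (Y q) : R^o) =
    g p (D p v X) (Y p) + g p (X p) (D p v Y).

Definition levi_civita (g : metric) (D : connection) : Prop :=
  metric_connection g D /\ torsion_free D.

(* The torsion as a (0,3)-tensor at [p]; by tensoriality any extensions of [u]
   and [v] to vector fields may be used. *)
Definition torsion3 (g : metric) (D : connection) (p : M) (u v w : V) : R :=
  g p (torsion D (coord_field p u) (coord_field p v) p) w.

(* Exterior derivative of a 2-form, without a factor 1/3; the bracket terms of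
   the invariant formula vanish on the coordinate fields. *)
Definition d2 (F : M -> V -> V -> R) (p : M) (u v w : V) : R :=
  let E := coord_field p in
  vder p u (fun q => F q (E v q) (E w q) : R^o) +
  vder p v (fun q => F q (E w q) (E u q) : R^o) +
  vder p w (fun q => F q (E u q) (E v q) : R^o).

(* (D_u F)(v, w). *)
Definition cov2 (D : connection) (F : M -> V -> V -> R) (p : M) (u v w : V) : R :=
  let E := coord_field p in
  vder p u (fun q => F q (E v q) (E w q) : R^o)
  - F p (D p u (E v)) w - F p v (D p u (E w)).

Definition orthonormal_basis (g : metric) (e : M -> 'I_m -> V) : Prop :=
  forall p i j, g p (e p i) (e p j) = (i == j)%:R.

(* Codifferential of a 2-form, [D] being the Levi-Civita connection. *)
Definition codiff (D : connection) (e : M -> 'I_m -> V)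
    (F : M -> V -> V -> R) (p : M) (w : V) : R :=
  - \sum_(i < m) cov2 D F p (e p i) (e p i) w.

End Calculus.

(* Pointwise algebra of forms on a tangent space with an endomorphism [A],
   [A *m A = - 1]. *)

Section Forms.
Variables (R : realType) (m : nat).
Local Notation V := ('cV[R]_m).

Definition type12_21 (A : 'M[R]_m) (t : V -> V -> V -> R) : Prop :=
  forall u v w, t u v w =
    t (A *m u) (A *m v) w + t (A *m u) v (A *m w) + t u (A *m v) (A *m w).

Definition type30_03 (A : 'M[R]_m) (t : V -> V -> V -> R) : Prop :=
  forall u v w, t (A *m u) (A *m v) w = - t u v w /\
    t (A *m u) v (A *m w) = - t u v w /\ t u (A *m v) (A *m w) = - t u v w.

(* The (1,2)+(2,1)-part, i.e. the component of [t] of type (1,2)+(2,1) in the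
   decomposition into types (1,2)+(2,1) and (3,0)+(0,3): see
   [part12_21_decomposition] and [part12_21_unique]. *)
Definition part12_21 (A : 'M[R]_m) (t : V -> V -> V -> R) (u v w : V) : R :=
  4^-1 * (3 * t u v w + t (A *m u) (A *m v) w +
          t (A *m u) v (A *m w) + t u (A *m v) (A *m w)).

Lemma part12_21_decomposition (A : 'M[R]_m) (t : V -> V -> V -> R) :
  A *m A = - 1%:M ->
  (forall u v w, t (- u) v w = - t u v w) ->
  (forall u v w, t u (- v) w = - t u v w) ->
  (forall u v w, t u v (- w) = - t u v w) ->
  type12_21 A (part12_21 A t) /\
  type30_03 A (fun u v w => t u v w - part12_21 A t u v w).
Proof.
move=> AA t1 t2 t3.
have AAK (x : V) : A *m (A *m x) = - x by rewrite mulmxA AA mulNmx mul1mx.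
split=> [u v w|u v w]; rewrite /part12_21 ?AAK ?t1 ?t2 ?t3.
  by field.
by split; [|split]; field.
Qed.

Lemma part12_21_unique (A : 'M[R]_m) (t t1 t2 : V -> V -> V -> R) :
  type12_21 A t1 -> type30_03 A t2 ->
  (forall u v w, t u v w = t1 u v w + t2 u v w) ->
  forall u v w, part12_21 A t u v w = t1 u v w.
Proof.
move=> h1 h2 ht u v w; rewrite /part12_21 !ht.
have [-> [-> ->]] := h2 u v w.
by rewrite (h1 u v w); field.
Qed.

(* The action of [A] on 1-forms. *)
Definition J1form (A : 'M[R]_m) (psi : V -> R) (u : V) : R := - psi (A *m u).

Definition wedge12 (psi : V -> R) (F : V -> V -> R) (u v w : V) : R :=
  psi u * F v w + psi v * F w u + psi w * F u v.

End Forms.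

Section Quaternionic.
Variables (R : realType) (m : nat) (M : manifold R m).
Local Notation V := ('cV[R]_m).
Implicit Types (Q : M -> set 'M[R]_m) (J : 'I_3 -> M -> 'M[R]_m).

(* The indices 1, 2, 3 are 0, 1, 2 : 'I_3, where addition is modulo 3; hence the
   cyclic permutations of (1, 2, 3) are the triples (a, a + 1, a + 2). *)
Definition admissible_basis Q (U : set M) J : Prop :=
  open U /\ (forall a, smooth_endo U (J a)) /\
  forall q, U q ->
    (forall a, J a q *m J a q = - 1%:M) /\
    J 0 q *m J 1 q = J 2 q /\
    J 1 q *m J 0 q = - J 2 q /\
    Q q = [set A | exists x : 'I_3 -> R, A = \sum_(a < 3) x a *: J a q].

Definition almost_quaternionic Q : Prop :=
  forall p, exists U J, U p /\ admissible_basis Q U J.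

(* The connection induced on endomorphism fields maps local sections of Q to
   sections of Q. *)
Definition quaternionic_connection Q (D : connection M) : Prop :=
  forall (U : set M) (A : M -> 'M[R]_m) p v, open U -> U p ->
    smooth_endo U A -> (forall q, U q -> Q q (A q)) ->
    exists2 B, Q p B &
      forall (W : set M) Y, open W -> W p -> W `<=` U -> smooth_field W Y ->
        D p v (fun q => A q *m Y q) - A p *m D p v Y = B *m Y p.

Definition quaternionic_manifold Q : Prop :=
  almost_quaternionic Q /\
  exists D : connection M, torsion_free D /\ quaternionic_connection Q D.

Definition Q_hermitian (g : metric M) Q : Prop :=
  forall p A, Q p A -> A *m A = - 1%:M ->
    forall u v, g p (A *m u) (A *m v) = g p u v.

Definition qkt_connection (g : metric M) Q (D : connection M) : Prop :=
  metric_connection g D /\ quaternionic_connection Q D /\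
  (forall p u v w, torsion3 g D p u v w = - torsion3 g D p v u w /\
                   torsion3 g D p u v w = - torsion3 g D p u w v) /\
  (forall U J, admissible_basis Q U J ->
     forall p a, U p -> type12_21 (J a p) (torsion3 g D p)).

Definition qkt_manifold (g : metric M) Q : Prop :=
  exists D : connection M, qkt_connection g Q D.

Section LocalExpressions.
(* [Dg] is the Levi-Civita connection of [g], [e] an orthonormal basis at each
   point and [J] a local admissible basis. *)
Variables (g : metric M) (Dg : connection M) (e : M -> 'I_m -> V).
Variable (J : 'I_3 -> M -> 'M[R]_m).

Definition kahler (a : 'I_3) (p : M) (u v : V) : R := g p u (J a p *m v).

Definition dkahler_plus (a : 'I_3) (p : M) : V -> V -> V -> R :=
  part12_21 (J a p) (d2 (kahler a) p).

Definition d_sub (a b : 'I_3) (p : M) (u v w : V) : R :=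
  - d2 (kahler b) p (J a p *m u) (J a p *m v) (J a p *m w).

Definition d_sub_plus (a : 'I_3) (p : M) : V -> V -> V -> R :=
  part12_21 (J a p) (d_sub a a p).

Definition lee1 (a : 'I_3) (p : M) (u : V) : R :=
  codiff Dg e (kahler a) p (J a p *m u).

Definition lee2 (a b : 'I_3) (p : M) (u : V) : R :=
  - 2^-1 * \sum_(i < m) dkahler_plus a p u (e p i) (J b p *m e p i).

Definition Kform (n : nat) (a : 'I_3) (p : M) (u : V) : R :=
  (1 - n%:R)^-1 * (J1form (J (a + 1) p) (lee1 a p) u + lee2 a (a + 2) p u).

Definition qkt_condition (n : nat) (a : 'I_3) (p : M) : Prop :=
  let b := a + 1 in let c := a + 2 in
  let K := Kform n in
  forall u v w,
    d_sub_plus a p u v w - d_sub_plus b p u v w =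
    2^-1 * (wedge12 (K a p) (kahler b p) u v w
            - wedge12 (J1form (J b p) (K b p)) (kahler a p) u v w
            - wedge12 (fun x => K b p x - J1form (J a p) (K a p) x)
                      (kahler c p) u v w).

Definition qkt_torsion (n : nat) (a : 'I_3) (p : M) (u v w : V) : R :=
  let b := a + 1 in let c := a + 2 in
  let K := Kform n in
  d_sub_plus a p u v w
  - 2^-1 * (wedge12 (J1form (J a p) (K a p)) (kahler c p) u v w
            + wedge12 (K a p) (kahler b p) u v w).

(* g(D_v Y, w) = g(Dg_v Y, w) + 1/2 T(v, Y, w) at [p]. *)
Definition skew_shift (D : connection M) (p : M) (T : V -> V -> V -> R) : Prop :=
  forall (U : set M) Y v w, open U -> U p -> smooth_field U Y ->
    g p (D p v Y) w = g p (Dg p v Y) w + 2^-1 * T v (Y p) w.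

End LocalExpressions.

End Quaternionic.

(* Main.v *)
Require Import Defs.
From HB Require Import structures.
From mathcomp Require Import all_boot all_order all_algebra.
From mathcomp Require Import all_classical all_reals all_analysis.
From mathcomp Require Import ring lra.
Import Order.TTheory GRing.Theory Num.Theory.
Import numFieldNormedType.Exports.
Local Open Scope classical_set_scope.
Local Open Scope ring_scope.

Set Implicit Arguments.
Unset Strict Implicit.
Unset Printing Implicit Defensive.

(** Write [(I, J, K)] for [(J_a, J_b, J_c)] with [(a, b, c)] cyclic, [F_I(u,v) = g(u,Iv)],
    and [E(u;v,w) = g(v, (Dg_u I) w)] for the Levi-Civita derivative of [F_I]; its cyclic
    sum is [dF_I].

    Necessity and uniqueness. A metric connection with skew torsion [T] is [Dg + T/2]
    ([cov_diff]). If it preserves [Q], then its derivative of [I] is [y K + z J] with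
    1-forms [y], [z], so that [E] is the sum of this term and of half the commutator with
    [T]. Taking the (1,2)+(2,1) part of [d_I F_I] gives [T] plus wedge products
    of [F_J] and [F_K] with a single 1-form [kap = - y + z o I] ([dsubplus_formula]). The traces
    defining the Lee forms express [kap]: the traces of [T] cancel because [T] has type
    (1,2)+(2,1) with respect to [J] ([trace_relation]), and [kap] is [K_a]
    ([lee_K_formula]). Hence [T] is given by the stated formula for each index
    ([torsion_formula]); comparing two indices yields the conditions, and the torsion
    determines the connection.

    Sufficiency. Under the conditions the three candidate torsions [qkt_torsion] of an
    admissible basis coincide in a 3-form [T] which is of type (1,2)+(2,1) for [I], [J], [K], hence for all
    structures in [Q] ([type_comb]). It has to be shown that [Dg + T/2] preserves [Q]. The
    derivative of a hermitian structure is determined by the Nijenhuis tensor and the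
    (1,2)+(2,1) part of [dF] ([nablaF_eq0]). The former comes from the torsion-free
    quaternionic connection and is expressed by one 1-form, the latter comes from the
    formula for [T] and is expressed by [K_a]; a derivative of the form [y K + z J] realizes
    any two such 1-forms ([nablaF_of_torsion_formula]).

    Globally, the pointwise uniqueness shows that [T] does not depend on the admissible
    basis ([torsion_exists]), so it is smooth because each candidate torsion is, and
    [Dg + T/2] is a smooth connection. The traces over the possibly discontinuous
    orthonormal basis are smooth since they can be computed in coordinate frames
    ([smooth_trace]). *)

(** * Functions of class C^k *)

Section CkGeneral.
Variables (R : realType) (E W : normedModType R).
Implicit Types (U : set E) (f g : E -> W).

(** Differentiability only sees the germ: [g - f] vanishes near [x], so it is
    a little-o of everything and has zero differential. *)
Lemma near_eq_differentiable f g (x : E) :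
  {near x, f =1 g} -> differentiable f x -> differentiable g x.
Proof.
move=> fg df; pose h : E -> W := g - f.
have h0 : \forall y \near x, h y = 0.
  by near do (rewrite /h fctE; apply/eqP; rewrite subr_eq0; apply/eqP; symmetry).
have hx : h x = 0 by exact: nbhs_singleton h0.
have dh0 : h \o shift x = cst (h x) + (\0 : {linear E -> W}) +o_ 0 id.
  apply/eqaddoP => _/posnumP[eps].
  have : \forall y \near (0 : E), h (y + x) = 0.
    by have := h0; rewrite (near_shift 0) /= subr0; apply.
  apply: filterS => y hy.
  by rewrite !fctE /= hy hx addr0 subr0 normr0 mulr_ge0.
have c0 : continuous ((\0 : {linear E -> W}) : E -> W) by exact: cst_continuous.
have dh : differentiable h x.
  by apply/diff_locallyP; rewrite (diff_unique c0 dh0).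
suff -> : g = f + h by apply: differentiableD.
by rewrite /h addrC subrK.
Unshelve. all: by end_near. Qed.

Lemma Ck_eq_on (k : nat) U f g : open U -> (forall x, U x -> f x = g x) ->
  Ck k U f -> Ck k U g.
Proof.
move=> oU; elim: k f g => [|k IH] f g fg /=.
  move=> cf x Ux; have := cf x Ux.
  rewrite /prop_for /continuous_at -(fg x Ux); apply: cvg_trans.
  apply: near_eq_cvg; have := open_nbhs_nbhs (conj oU Ux).
  by apply: filterS => y /fg ->.
have nfg x : U x -> {near x, f =1 g}.
  by move=> Ux; have := open_nbhs_nbhs (conj oU Ux); apply: filterS => y /fg.
move=> [df Df]; split => [x Ux|v].
  exact: near_eq_differentiable (nfg x Ux) (df x Ux).
apply: IH (Df v) => x Ux; exact: near_eq_derive (nfg x Ux).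
Qed.

Lemma Ck_subset (k : nat) U U' f : U' `<=` U -> Ck k U f -> Ck k U' f.
Proof.
move=> UU; elim: k f => [|k IH] f /=; first by move=> cf x /UU/cf.
by move=> [df Df]; split => [x /UU/df|v] //; exact: IH.
Qed.

Lemma Ck_pred (k : nat) U f : Ck k.+1 U f -> Ck k U f.
Proof.
elim: k f => [|k IH] f /=.
  by move=> [df _] x /df; exact: differentiable_continuous.
by move=> [df Df]; split => // v; apply: IH.
Qed.

(** Being C^k is a local property, which lets smoothness be checked in
    frames that exist only near a given point. *)
Lemma Ck_locally (k : nat) U f : open U ->
  (forall x, U x -> exists V : set E, [/\ open V, V x & Ck k V f]) -> Ck k U f.
Proof.
move=> oU; elim: k f => [|k IH] f /=.
  by move=> H x Ux; have [V [oV Vx]] := H x Ux; apply.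
move=> H; split => [x Ux|v].
  by have [V [oV Vx [d _]]] := H x Ux; exact: d.
apply: IH => x Ux; have [V [oV Vx [_ d]]] := H x Ux.
by exists V; split.
Qed.

Lemma Ck_cst (k : nat) U (w : W) : Ck k U (fun=> w).
Proof.
elim: k w => [|k IH] w /=; first by move=> x _; exact: cst_continuous.
split => [x _|v]; first exact: differentiable_cst.
suff -> : (fun x : E => 'D_v (fun=> w) x) = (fun=> 0) by [].
by apply/funext => x; exact: (derive_cst w).
Qed.

Lemma Ck_add (k : nat) U f g : open U ->
  Ck k U f -> Ck k U g -> Ck k U (fun x => f x + g x).
Proof.
move=> oU; elim: k f g => [|k IH] f g /=.
  by move=> cf cg x Ux; apply: continuousD; [exact: cf|exact: cg].
move=> [df Df] [dg Dg]; split => [x Ux|v].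
  by apply: differentiableD; [exact: df|exact: dg].
apply: (@Ck_eq_on _ _ (fun x => 'D_v f x + 'D_v g x)) => //; last exact: IH.
by move=> x Ux; symmetry; apply: (deriveD (f := f) (g := g)); apply: diff_derivable; auto.
Qed.

Lemma Ck_scale (k : nat) U (c : R) f : open U ->
  Ck k U f -> Ck k U (fun x => c *: f x).
Proof.
move=> oU; elim: k f => [|k IH] f /=.
  by move=> cf x Ux; apply: continuousZl_tmp; exact: cf.
move=> [df Df]; split => [x Ux|v].
  by apply: differentiableZ; exact: df.
apply: (@Ck_eq_on _ _ (fun x => c *: 'D_v f x)) => //; last exact: IH.
by move=> x Ux; symmetry; apply: (deriveZ (f := f)); apply: diff_derivable; auto.
Qed.

Lemma Ck_sum (k : nat) U (I : Type) (r : seq I) (F : I -> E -> W) : open U ->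
  (forall i, Ck k U (F i)) -> Ck k U (fun x => \sum_(i <- r) F i x).
Proof.
move=> oU FF; elim: r => [|i r IH].
  suff -> : (fun x => \sum_(j <- [::]) F j x) = (fun=> 0) by exact: Ck_cst.
  by apply/funext => x; rewrite big_nil.
suff -> : (fun x => \sum_(j <- i :: r) F j x) =
    (fun x => F i x + \sum_(j <- r) F j x) by exact: Ck_add.
by apply/funext => x; rewrite big_cons.
Qed.

End CkGeneral.

Section CkScalar.
Variables (R : realType) (E : normedModType R).
Implicit Types (U : set E) (f g : E -> R^o).

Lemma derive_mul f g (x v : E) : differentiable f x -> differentiable g x ->
  'D_v (fun y => f y * g y : R^o) x = f x * 'D_v g x + g x * 'D_v f x.
Proof. by move=> df dg; apply: (deriveM (f:=f) (g:=g)); apply: diff_derivable. Qed.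

Lemma Ck_mul (k : nat) U f g : open U ->
  Ck k U f -> Ck k U g -> Ck k U (fun x => f x * g x : R^o).
Proof.
move=> oU; elim: k f g => [|k IH] f g.
  by move=> cf cg x Ux; apply: continuousM; [exact: cf|exact: cg].
move=> Cf Cg; have [df Df] := Cf; have [dg Dg] := Cg; split => [x Ux|v].
  by apply: differentiableM; [exact: df|exact: dg].
apply: (@Ck_eq_on _ _ _ _ _ (fun x => f x * 'D_v g x + g x * 'D_v f x)) => //.
  by move=> x Ux; rewrite derive_mul; auto.
by apply: Ck_add => //; apply: IH; [exact: Ck_pred Cf|exact: Dg|exact: Ck_pred Cg|exact: Df].
Qed.

Lemma Ck_prod (k : nat) U (I : Type) (r : seq I) (F : I -> E -> R^o) : open U ->
  (forall i, Ck k U (F i)) -> Ck k U (fun x => \prod_(i <- r) F i x : R^o).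
Proof.
move=> oU FF; elim: r => [|i r IH].
  suff -> : (fun x => \prod_(j <- [::]) F j x : R^o) = (fun=> 1) by exact: Ck_cst.
  by apply/funext => x; rewrite big_nil.
suff -> : (fun x => \prod_(j <- i :: r) F j x : R^o) =
    (fun x => F i x * \prod_(j <- r) F j x) by exact: Ck_mul.
by apply/funext => x; rewrite big_cons.
Qed.

Lemma Ck_inv (k : nat) U f : open U -> (forall x, U x -> f x != 0) ->
  Ck k U f -> Ck k U (fun x => (f x)^-1 : R^o).
Proof.
move=> oU f0; elim: k => [|k IH].
  by move=> cf x Ux; apply: continuousV; auto.
move=> Cf; have [df Df] := Cf; split => [x Ux|v].
  by apply: differentiableV; [exact: df|exact: f0].
have CI := IH (Ck_pred Cf).
apply: (@Ck_eq_on _ _ _ _ _ (fun x => (-1) *: (((f x)^-1 * (f x)^-1) * 'D_v f x) : R^o)) => //.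
  move=> x Ux; have fx0 := f0 x Ux.
  have dfx : derivable f x v by apply: diff_derivable; exact: df.
  by rewrite deriveV// scaleN1r -mulNr -expr2 exprVn.
apply: Ck_scale => //; apply: Ck_mul => //; last exact: Df.
exact: (Ck_mul oU CI CI).
Qed.

End CkScalar.

Section CkVector.
Variables (R : realType) (E : normedModType R) (m : nat).
Local Notation V := 'cV[R]_m.
Implicit Types (U : set E) (F : E -> V).

Definition std_basis (i : 'I_m) : V := delta_mx i 0.

Lemma cV_decomp (v : V) : v = \sum_(i < m) v i 0 *: std_basis i.
Proof.
rewrite {1}[v]matrix_sum_delta; apply: eq_bigr => i _.
by rewrite big_ord_recl big_ord0 addr0.
Qed.

Definition entry (i : 'I_m) (v : V) : R^o := v i 0.

Lemma entry_differentiable i v : differentiable (entry i) v.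
Proof. exact: differentiable_coord. Qed.

Lemma derive_entry F (x v : E) i : differentiable F x ->
  'D_v (fun y => entry i (F y)) x = entry i ('D_v F x).
Proof.
by move=> dF; rewrite derive_mx ?mxE /entry ?mxE //; exact: diff_derivable.
Qed.

Lemma Ck_entry (k : nat) U F i : open U ->
  Ck k U F -> Ck k U (fun x => entry i (F x)).
Proof.
move=> oU; elim: k F => [|k IH] F /=.
  move=> cF x Ux; apply: (@continuous_comp _ _ _ F (entry i)); first exact: cF.
  exact: differentiable_continuous (entry_differentiable i (F x)).
move=> [dF DF]; split => [x Ux|v].
  by apply: (differentiable_comp (dF x Ux)); exact: entry_differentiable.
apply: (@Ck_eq_on _ _ _ _ _ (fun x => entry i ('D_v F x))) => //; last exact: IH.
by move=> x Ux; rewrite derive_entry//; exact: dF.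
Qed.

Lemma Ck_scalel (k : nat) U (f : E -> R^o) (w : V) : open U ->
  Ck k U f -> Ck k U (fun x => f x *: w).
Proof.
move=> oU; elim: k f => [|k IH] f /=.
  move=> cf x Ux; have := cf x Ux => cfx.
  by apply: (@continuousZr_tmp _ _ _ f w x).
move=> [df Df]; split => [x Ux|v].
  by apply: differentiableZl; exact: df.
apply: (@Ck_eq_on _ _ _ _ _ (fun x => 'D_v f x *: w)) => //; last exact: IH.
move=> x Ux; have dfx := df x Ux.
have dfw : differentiable (fun z => f z *: w) x by exact: differentiableZl.
by rewrite !deriveE// diffZl.
Qed.

Lemma Ck_vector (k : nat) U F : open U ->
  (forall i, Ck k U (fun x => entry i (F x))) -> Ck k U F.
Proof.
move=> oU CF; have -> : F = fun x => \sum_i entry i (F x) *: std_basis i.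
  by apply/funext => x; rewrite {1}[F x]cV_decomp.
by apply: Ck_sum => // i; exact: Ck_scalel.
Qed.

End CkVector.

Section CkComp.
Variables (R : realType) (E : normedModType R) (m : nat).
Local Notation V := 'cV[R]_m.

Lemma derive_comp (W : normedModType R) (F : E -> V) (h : V -> W) (x v : E) :
  differentiable F x -> differentiable h (F x) ->
  'D_v (h \o F) x = 'D_('D_v F x) h (F x).
Proof.
move=> dF dh; have dhF := differentiable_comp dF dh.
by rewrite !deriveE// diff_comp.
Qed.

Lemma derive_lincomb (W : normedModType R) (h : V -> W) (x v : V) :
  differentiable h x -> 'D_v h x = \sum_i v i 0 *: 'D_(std_basis R i) h x.
Proof.
move=> dh; rewrite deriveE// {1}[v]cV_decomp linear_sum.
by apply: eq_bigr => i _; rewrite linearZ deriveE.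
Qed.

(** Induction on [k] by the chain rule: the derivative of a composite is a sum
    of products of entries of the derivative of [F] with partial derivatives of
    [h] composed with [F], all of one class lower. *)
Lemma Ck_comp_scalar (k : nat) (U : set E) (U' : set V) (F : E -> V) (h : V -> R^o) :
  open U -> (forall x, U x -> U' (F x)) ->
  Ck k U F -> Ck k U' h -> Ck k U (h \o F).
Proof.
move=> oU UU'; elim: k h => [|k IH] h.
  by move=> cF ch x Ux; apply: continuous_comp; [exact: cF|apply: ch; exact: UU'].
move=> CF Ch; have [dF DF] := CF; have [dh Dh] := Ch.
split => [x Ux|v].
  by apply: differentiable_comp; [exact: dF|apply: dh; exact: UU'].
apply: (@Ck_eq_on _ _ _ _ _
  (fun x => \sum_i (entry i ('D_v F x) * ('D_(std_basis R i) h \o F) x : R^o))) => //.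
  move=> x Ux; have dFx := dF x Ux; have dhx := dh _ (UU' x Ux).
  by rewrite derive_comp// derive_lincomb.
apply: Ck_sum => // i; apply: (Ck_mul oU (f:=fun x => entry i ('D_v F x))).
  by apply: Ck_entry => //; exact: DF.
by apply: IH; [exact: Ck_pred CF|exact: Dh].
Qed.

Lemma Ck_comp (p k : nat) (U : set E) (U' : set V) (F : E -> V) (h : V -> 'cV[R]_p) :
  open U -> open U' -> (forall x, U x -> U' (F x)) ->
  Ck k U F -> Ck k U' h -> Ck k U (h \o F).
Proof.
move=> oU oU' UU' CF Ch; apply: Ck_vector => // i.
by apply: (@Ck_comp_scalar _ _ U' F (fun x => entry i (h x))) => //; exact: Ck_entry.
Qed.

End CkComp.

(** * Charts, vector fields and smoothness on a manifold *)

Section Charts.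
Variables (R : realType) (m : nat) (M : manifold R m).
Local Notation V := 'cV[R]_m.
Implicit Types (c : chart R m M) (U W : set M) (p q : M) (X Y : M -> V) (f : M -> R^o).

Definition chart_img c U : set V := fwd c @` (dom c `&` U).

Lemma mem_chart_img c U q : dom c q -> U q -> chart_img c U (fwd c q).
Proof. by move=> cq Uq; exists q. Qed.

Lemma chart_imgP c U x : chart_img c U x -> [/\ dom c (bwd c x), U (bwd c x) & fwd c (bwd c x) = x].
Proof. by move=> [q [cq Uq] <-]; rewrite fwdK. Qed.

Lemma open_chart_img c U : open U -> open (chart_img c U).
Proof.
move=> oU; rewrite openE => x ix; have [cx Ux fx] := chart_imgP ix.
have dx : (fwd c @` dom c) x by exists (bwd c x).
have n1 : nbhs x (fwd c @` dom c) by apply: open_nbhs_nbhs; split=> //; exact: img_open.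
have n2 : nbhs x (bwd c @^-1` U).
  by apply: (bwd_continuous dx); apply: open_nbhs_nbhs; split.
apply: filterS (filterI n1 n2) => y [[q cq <-]] /=; rewrite /preimage/= fwdK//.
by move=> Uq; exists q.
Qed.

Lemma near_chart_img c U q : open U -> dom c q -> U q -> nbhs (fwd c q) (chart_img c U).
Proof.
by move=> oU cq Uq; apply: open_nbhs_nbhs; split; [exact: open_chart_img|exact: mem_chart_img].
Qed.

Lemma transition_smooth c c' : atlas c -> atlas c' ->
  smooth_on (chart_img c (dom c')) (fwd c' \o bwd c).
Proof. exact: atlas_compatible. Qed.

Lemma transition_differentiable c c' q : atlas c -> atlas c' -> dom c q -> dom c' q ->
  differentiable (fwd c' \o bwd c) (fwd c q).
Proof.
move=> ac ac' cq cq'; have [+ _] := transition_smooth ac ac' 1.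
by apply; exact: mem_chart_img.
Qed.

(** The chain rule for transition maps; this cocycle identity is what makes
    the components of a vector field behave tensorially. *)
Lemma tchange_comp c c' c'' q v : atlas c -> atlas c' -> atlas c'' ->
  dom c q -> dom c' q -> dom c'' q ->
  tchange c' c'' q (tchange c c' q v) = tchange c c'' q v.
Proof.
move=> ac ac' ac'' cq cq' cq''; rewrite /tchange.
have e : (fwd c' \o bwd c) (fwd c q) = fwd c' q by rewrite /= fwdK.
rewrite -e -derive_comp; last first.
- by rewrite e; exact: transition_differentiable.
- exact: transition_differentiable.
apply: near_eq_derive.
have := near_chart_img (dom_open c') cq cq'; apply: filterS => x /chart_imgP[_ dx _] /=.
by rewrite fwdK.
Qed.

Lemma tchange_id c q v : dom c q -> tchange c c q v = v.
Proof.
move=> cq; rewrite /tchange -[RHS](derive_id (fwd c q) v).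
apply: near_eq_derive; have := near_chart_img openT cq I.
by apply: filterS => x /chart_imgP[].
Qed.

Lemma tchange_linear c c' q : atlas c -> atlas c' -> dom c q -> dom c' q ->
  linear (tchange c c' q).
Proof.
move=> ac ac' cq cq' a u v; rewrite /tchange !deriveE ?linearP//;
exact: transition_differentiable.
Qed.

Lemma tchange_sum c c' q : atlas c -> atlas c' -> dom c q -> dom c' q ->
  forall (I : Type) (r : seq I) (F : I -> V),
  tchange c c' q (\sum_(i <- r) F i) = \sum_(i <- r) tchange c c' q (F i).
Proof.
move=> ac ac' cq cq' I r F; rewrite /tchange deriveE; last exact: transition_differentiable.
by rewrite linear_sum; apply: eq_bigr => i _; rewrite deriveE//; exact: transition_differentiable.
Qed.

Lemma tchangeZ c c' q a v : atlas c -> atlas c' -> dom c q -> dom c' q ->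
  tchange c c' q (a *: v) = a *: tchange c c' q v.
Proof.
move=> ac ac' cq cq'; have := tchange_linear ac ac' cq cq' a v 0.
by rewrite addr0 => ->; rewrite {2}/tchange derive0 addr0.
Qed.

Lemma tchangeD c c' q u v : atlas c -> atlas c' -> dom c q -> dom c' q ->
  tchange c c' q (u + v) = tchange c c' q u + tchange c c' q v.
Proof.
by move=> ac ac' cq cq'; have := tchange_linear ac ac' cq cq' 1 u v; rewrite !scale1r.
Qed.

Local Hint Resolve chart_at_atlas chart_at_dom : core.

Lemma field_in_self X p : field_in (chart_at p) X p = X p.
Proof. by rewrite /field_in tchange_id. Qed.

Lemma coord_field_self p u : coord_field p u p = u.
Proof. by rewrite /coord_field tchange_id. Qed.

Lemma field_in_coord c p u q : atlas c -> dom c q -> dom (chart_at p) q ->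
  field_in c (coord_field p u) q = tchange (chart_at p) c q u.
Proof. by move=> ac cq pq; rewrite /field_in /coord_field tchange_comp. Qed.

Lemma coord_field_in p X q : dom (chart_at p) q ->
  coord_field p (field_in (chart_at p) X q) q = X q.
Proof. by move=> pq; rewrite /coord_field /field_in tchange_comp // tchange_id. Qed.

Definition chart_domain p : set M := dom (chart_at p).

Lemma open_chart_domain p : open (chart_domain p). Proof. exact: dom_open. Qed.

Lemma smooth_fun_eq U f f' : open U -> (forall q, U q -> f q = f' q) ->
  smooth_fun U f -> smooth_fun U f'.
Proof.
move=> oU ff sf c ac k; apply: Ck_eq_on (sf c ac k); first exact: open_chart_img.
by move=> x /chart_imgP[_ Ux _]; exact: ff.
Qed.

Lemma smooth_field_eq U X X' : open U -> (forall q, U q -> X q = X' q) ->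
  smooth_field U X -> smooth_field U X'.
Proof.
move=> oU ff sf c ac k; apply: Ck_eq_on (sf c ac k); first exact: open_chart_img.
by move=> x /chart_imgP[_ Ux _]; rewrite /= /field_in ff.
Qed.

Lemma chart_img_subset c U U' : U' `<=` U -> chart_img c U' `<=` chart_img c U.
Proof. by move=> UU x [q [cq Uq] <-]; exists q => //; split => //; exact: UU. Qed.

Lemma smooth_fun_subset U U' f : U' `<=` U -> smooth_fun U f -> smooth_fun U' f.
Proof. by move=> UU sf c ac k; apply: Ck_subset (sf c ac k); exact: chart_img_subset. Qed.

Lemma smooth_field_subset U U' X : U' `<=` U -> smooth_field U X -> smooth_field U' X.
Proof. by move=> UU sf c ac k; apply: Ck_subset (sf c ac k); exact: chart_img_subset. Qed.

Lemma smooth_fun_locally U f : open U ->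
  (forall q, U q -> exists W, [/\ open W, W q & smooth_fun W f]) -> smooth_fun U f.
Proof.
move=> oU H c ac k; apply: Ck_locally; first exact: open_chart_img.
move=> x /chart_imgP[cx Ux fx]; have [W [oW Wx sW]] := H _ Ux.
exists (chart_img c W); split; [exact: open_chart_img|by rewrite -fx; exact: mem_chart_img|exact: sW].
Qed.

Lemma smooth_field_locally U X : open U ->
  (forall q, U q -> exists W, [/\ open W, W q & smooth_field W X]) -> smooth_field U X.
Proof.
move=> oU H c ac k; apply: Ck_locally; first exact: open_chart_img.
move=> x /chart_imgP[cx Ux fx]; have [W [oW Wx sW]] := H _ Ux.
exists (chart_img c W); split; [exact: open_chart_img|by rewrite -fx; exact: mem_chart_img|exact: sW].
Qed.

Lemma smooth_fun_cst U (a : R) : smooth_fun U (fun=> a : R^o).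
Proof. by move=> c ac k; exact: Ck_cst. Qed.

Lemma smooth_funD U f f' : open U -> smooth_fun U f -> smooth_fun U f' ->
  smooth_fun U (fun q => f q + f' q).
Proof.
move=> oU sf sf' c ac k.
exact (Ck_add (open_chart_img (c:=c) oU) (sf c ac k) (sf' c ac k)).
Qed.

Lemma smooth_funM U f f' : open U -> smooth_fun U f -> smooth_fun U f' ->
  smooth_fun U (fun q => f q * f' q : R^o).
Proof.
move=> oU sf sf' c ac k.
by apply: (Ck_mul (open_chart_img (c:=c) oU) (sf c ac k) (sf' c ac k)).
Qed.

Lemma smooth_funZ U (a : R) f : open U -> smooth_fun U f ->
  smooth_fun U (fun q => a * f q : R^o).
Proof. by move=> oU sf; apply: smooth_funM => //; exact: smooth_fun_cst. Qed.

Lemma smooth_funN U f : open U -> smooth_fun U f -> smooth_fun U (fun q => - f q).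
Proof.
move=> oU sf; apply: (smooth_fun_eq oU (f:=fun q => -1 * f q)); last exact: smooth_funZ.
by move=> q _; rewrite mulN1r.
Qed.

Lemma smooth_funB U f f' : open U -> smooth_fun U f -> smooth_fun U f' ->
  smooth_fun U (fun q => f q - f' q).
Proof. by move=> oU sf sf'; apply: smooth_funD => //; exact: smooth_funN. Qed.

Lemma smooth_funV U f : open U -> (forall q, U q -> f q != 0) -> smooth_fun U f ->
  smooth_fun U (fun q => (f q)^-1 : R^o).
Proof.
move=> oU f0 sf c ac k.
by apply: (Ck_inv (open_chart_img (c:=c) oU) _ (sf c ac k)) => x /chart_imgP[_ Ux _]; exact: f0.
Qed.

Lemma smooth_fun_sum U (I : Type) (r : seq I) (F : I -> M -> R^o) : open U ->
  (forall i, smooth_fun U (F i)) -> smooth_fun U (fun q => \sum_(i <- r) F i q).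
Proof.
move=> oU sF c ac k.
by apply: (@Ck_sum _ _ _ _ _ _ _ (fun i => F i \o bwd c)) => [|i]; [exact: open_chart_img|exact: sF].
Qed.

Lemma smooth_fun_prod U (I : Type) (r : seq I) (F : I -> M -> R^o) : open U ->
  (forall i, smooth_fun U (F i)) -> smooth_fun U (fun q => \prod_(i <- r) F i q : R^o).
Proof.
move=> oU sF c ac k.
by apply: (@Ck_prod _ _ _ _ _ _ (fun i => F i \o bwd c)) => [|i]; [exact: open_chart_img|exact: sF].
Qed.

Lemma smooth_fieldD U X Y : open U -> smooth_field U X -> smooth_field U Y ->
  smooth_field U (fun q => X q + Y q).
Proof.
move=> oU sX sY c ac k.
apply: (Ck_eq_on _ _ (Ck_add (open_chart_img (c:=c) oU) (sX c ac k) (sY c ac k))); first exact: open_chart_img.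
by move=> x /chart_imgP[cx Ux _]; rewrite /= /field_in tchangeD.
Qed.

Lemma smooth_fieldZ U f X : open U -> smooth_fun U f -> smooth_field U X ->
  smooth_field U (fun q => f q *: X q).
Proof.
move=> oU sf sX c ac k; have oI := open_chart_img (c:=c) oU; apply: Ck_vector => // i.
apply: (Ck_eq_on oI _ (Ck_mul oI (sf c ac k) (Ck_entry i oI (sX c ac k)))).
by move=> x /chart_imgP[cx Ux _]; rewrite /= /field_in tchangeZ // /entry mxE.
Qed.

Lemma smooth_field0 U : open U -> smooth_field U (fun=> 0).
Proof.
move=> oU c ac k; apply: (Ck_eq_on _ _ (Ck_cst _ _ 0)); first exact: open_chart_img.
by move=> x _; rewrite /= /field_in /tchange derive0.
Qed.

Lemma smooth_field_sum U (I : Type) (r : seq I) (F : I -> M -> V) : open U ->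
  (forall i, smooth_field U (F i)) -> smooth_field U (fun q => \sum_(i <- r) F i q).
Proof.
move=> oU sF; elim: r => [|i r IH].
  apply: (smooth_field_eq oU _ (smooth_field0 oU)) => q _; by rewrite big_nil.
apply: (smooth_field_eq oU _ (smooth_fieldD oU (sF i) IH)) => q _; by rewrite big_cons.
Qed.

Lemma smooth_fieldB U X Y : open U -> smooth_field U X -> smooth_field U Y ->
  smooth_field U (fun q => X q - Y q).
Proof.
move=> oU sX sY; have sN := smooth_fieldZ oU (smooth_fun_cst U (-1)) sY.
by apply: (smooth_field_eq oU _ (smooth_fieldD oU sX sN)) => q _; rewrite scaleN1r.
Qed.

(** In another chart the components are the partial derivatives of the
    transition map, composed with the inverse transition map. *)
Lemma smooth_coord_field p u : smooth_field (chart_domain p) (coord_field p u).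
Proof.
move=> c ac k; have oI : open (chart_img c (chart_domain p)) by apply: open_chart_img; exact: open_chart_domain.
pose tau := fwd c \o bwd (chart_at p).
have /= [_ Dtau] := transition_smooth (chart_at_atlas p) ac k.+1.
have oI' : open (chart_img (chart_at p) (dom c)) by apply: open_chart_img; exact: dom_open.
have Ct := transition_smooth ac (chart_at_atlas p) k.
apply: (Ck_eq_on oI _ (Ck_comp oI oI' _ Ct (Dtau u))) => x /chart_imgP[cx px fx].
  by rewrite /= field_in_coord.
by apply: mem_chart_img.
Qed.

Lemma smooth_entry p X U i : open U -> U `<=` chart_domain p -> smooth_field U X ->
  smooth_fun U (fun q => entry i (field_in (chart_at p) X q)).
Proof.
move=> oU Up sX c ac k; have oI := open_chart_img (c:=c) oU.
have oI' := open_chart_img (c:=chart_at p) oU.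
have Ct := Ck_subset (chart_img_subset Up) (transition_smooth ac (chart_at_atlas p) k).
have CX := Ck_entry i oI' (sX _ (chart_at_atlas p) k).
have UU x : chart_img c U x -> chart_img (chart_at p) U ((fwd (chart_at p) \o bwd c) x).
  by move=> /chart_imgP[cx Ux _]; apply: mem_chart_img => //; exact: Up.
apply: (Ck_eq_on oI _ (Ck_comp_scalar oI UU Ct CX)) => x /chart_imgP[cx Ux _] /=.
by rewrite fwdK //; exact: Up.
Qed.

(** The coordinate fields of one chart form a frame on its whole domain. *)
Lemma field_decomp p X q : chart_domain p q ->
  X q = \sum_i entry i (field_in (chart_at p) X q) *: coord_field p (std_basis R i) q.
Proof.
move=> pq; rewrite -[LHS](coord_field_in X pq) {1}[field_in _ _ _]cV_decomp.
rewrite /coord_field tchange_sum //; apply: eq_bigr => i _; by rewrite tchangeZ.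
Qed.

Lemma smooth_field_differentiable p U X : open U -> U p -> smooth_field U X ->
  differentiable (field_in (chart_at p) X \o bwd (chart_at p)) (fwd (chart_at p) p).
Proof.
move=> oU Up sX; have /= [+ _] := sX _ (chart_at_atlas p) 1; apply.
exact: mem_chart_img.
Qed.

Lemma smooth_fun_differentiable p U f : open U -> U p -> smooth_fun U f ->
  differentiable (f \o bwd (chart_at p)) (fwd (chart_at p) p).
Proof.
move=> oU Up sX; have /= [+ _] := sX _ (chart_at_atlas p) 1; apply.
exact: mem_chart_img.
Qed.

Lemma vder_eq (W : normedModType R) U p v (f f' : M -> W) : open U -> U p ->
  (forall q, U q -> f q = f' q) -> vder p v f = vder p v f'.
Proof.
move=> oU Up ff; apply: near_eq_derive.
have := near_chart_img oU (chart_at_dom p) Up; apply: filterS => x /chart_imgP[_ Ux _] /=.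
exact: ff.
Qed.

Lemma vder_cst (W : normedModType R) p v (w : W) : vder p v (fun=> w) = 0.
Proof. exact: derive_cst. Qed.

Lemma vderD U p v f f' : open U -> U p -> smooth_fun U f -> smooth_fun U f' ->
  vder p v (fun q => f q + f' q) = vder p v f + vder p v f'.
Proof.
move=> oU Up sf sf'.
apply: (deriveD (f := f \o bwd (chart_at p)) (g := f' \o bwd (chart_at p)));
  apply: diff_derivable; [exact: smooth_fun_differentiable sf|exact: smooth_fun_differentiable sf'].
Qed.

Lemma vder_entry U p v X i : open U -> U p -> smooth_field U X ->
  vder p v (fun q => entry i (field_in (chart_at p) X q)) =
  entry i (vder p v (field_in (chart_at p) X)).
Proof.
move=> oU Up sX.
by apply: derive_entry; exact: smooth_field_differentiable sX.
Qed.

(** Both fields have constant components in the chart at [p]. *)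
Lemma lie_coord p u v : lie (coord_field p u) (coord_field p v) p = 0.
Proof.
have H w x : vder p w (field_in (chart_at p) (coord_field p x)) = 0.
  rewrite -[RHS](vder_cst p w x).
  apply: (vder_eq w (open_chart_domain p) (chart_at_dom p)) => q pq.
  by rewrite field_in_coord // tchange_id.
by rewrite /lie !H subrr.
Qed.

Lemma coord_field_linear p q a u v : chart_domain p q ->
  coord_field p (a *: u + v) q = a *: coord_field p u q + coord_field p v q.
Proof. by move=> pq; rewrite /coord_field tchange_linear. Qed.

End Charts.

(** * Covariant derivatives of fields and of endomorphism fields *)

Lemma matrix_eq_mulv (R : realType) (m : nat) (A B : 'M[R]_m) :
  (forall u : 'cV[R]_m, A *m u = B *m u) -> A = B.
Proof.
move=> AB; apply/matrixP => i j.
by have := congr1 (fun C : 'cV_m => C i 0) (AB (delta_mx j 0)); rewrite -!colE !mxE.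
Qed.

Section Connections.
Variables (R : realType) (m : nat) (M : manifold R m).
Local Notation V := 'cV[R]_m.
Implicit Types (U W : set M) (p q : M) (X Y : M -> V) (f : M -> R^o) (A : M -> 'M[R]_m).
Implicit Types (D : connection M).
Local Notation E i p := (coord_field p (std_basis R i)).

Lemma smooth_coord_fieldS U p u : U `<=` chart_domain p -> smooth_field U (coord_field p u).
Proof. by move=> Up; apply: smooth_field_subset Up _; exact: smooth_coord_field. Qed.

Lemma cov0 D U p v : open U -> U p -> D p v (fun=> 0) = 0.
Proof.
move=> oU Up; have s0 := smooth_field0 oU.
have := cov_leibniz D v oU Up (smooth_fun_cst U 0) s0.
by rewrite vder_cst !scale0r addr0.
Qed.

Lemma cov_sum D U p v (I : Type) (r : seq I) (F : I -> M -> V) : open U -> U p ->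
  (forall i, smooth_field U (F i)) ->
  D p v (fun q => \sum_(i <- r) F i q) = \sum_(i <- r) D p v (F i).
Proof.
move=> oU Up sF; elim: r => [|i r IH].
  rewrite big_nil -[RHS](cov0 D v oU Up); congr (D p v _).
  by apply/funext => q; rewrite big_nil.
rewrite big_cons -IH -(cov_add D v oU Up (sF i)); last exact: smooth_field_sum.
by congr (D p v _); apply/funext => q; rewrite big_cons.
Qed.

Lemma cov_expand D U p v (I : Type) (r : seq I) (y : I -> M -> R^o) (F : I -> M -> V) :
  open U -> U p -> (forall i, smooth_fun U (y i)) -> (forall i, smooth_field U (F i)) ->
  D p v (fun q => \sum_(i <- r) y i q *: F i q) =
  \sum_(i <- r) (y i p *: D p v (F i) + vder p v (y i) *: F i p).
Proof.
move=> oU Up sy sF; rewrite (cov_sum _ _ _ (F := fun i q => y i q *: F i q) oU Up).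
  by apply: eq_bigr => i _; rewrite (cov_leibniz D v oU Up).
by move=> i; exact: smooth_fieldZ.
Qed.

Lemma cov_coord_linear D p v : linear (fun u => D p v (coord_field p u)).
Proof.
move=> a u w; have oU := @open_chart_domain _ _ _ p; have Up : chart_domain p p by exact: chart_at_dom.
have su := smooth_coord_field p u; have sw := smooth_coord_field p w.
have sa := smooth_fieldZ oU (smooth_fun_cst (chart_domain p) a) su.
have e q : chart_domain p q ->
    coord_field p (a *: u + w) q = a *: coord_field p u q + coord_field p w q.
  by move=> pq; rewrite coord_field_linear.
have -> := @cov_local _ _ _ D (chart_domain p) _ _ p v oU Up (smooth_coord_field p _) e.
rewrite (cov_add D v oU Up sa sw).
rewrite (cov_leibniz D v oU Up (smooth_fun_cst (chart_domain p) a) su).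
by rewrite vder_cst scale0r addr0.
Qed.

(** A field is a combination of coordinate fields with smooth coefficients, so
    the Leibniz rule reduces a connection at [p] to the derivative of the
    components and to the Christoffel symbols [D p v (coord_field p u)]. All
    comparisons of two connections go through this formula. *)
Lemma cov_decomp D U p v Y : open U -> U p -> smooth_field U Y ->
  D p v Y = vder p v (field_in (chart_at p) Y) + D p v (coord_field p (Y p)).
Proof.
move=> oU Up sY; pose W := U `&` chart_domain p.
have oW : open W by apply: openI => //; exact: open_chart_domain.
have Wp : W p by split => //; exact: chart_at_dom.
have WU : W `<=` U by move=> q [].
have Wc : W `<=` chart_domain p by move=> q [].
have sY' := smooth_field_subset WU sY.
have sy i := smooth_entry i oW Wc sY'.
have sE i : smooth_field W (E i p) by exact: smooth_coord_fieldS.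
rewrite (@cov_local _ _ _ D W Y (fun q => \sum_i entry i (field_in (chart_at p) Y q) *: E i p q)) //;
  last by move=> q [_ pq]; rewrite -field_decomp.
rewrite (cov_expand D v _ oW Wp sy sE) big_split /= addrC; congr (_ + _).
  rewrite [RHS]cV_decomp; apply: eq_bigr => i _.
  by rewrite (vder_entry v i oW Wp sY') coord_field_self.
rewrite field_in_self {2}[Y p]cV_decomp.
pose L := GRing.isLinear.Build _ _ _ _ _ (cov_coord_linear D p v).
pose f : {linear V -> V} := HB.pack (fun u => D p v (coord_field p u)) L.
by rewrite -[RHS]/(f _) linear_sum; apply: eq_bigr => i _; rewrite linearZ.
Qed.

(** The covariant derivative of the endomorphism field [A]; it is defined on
    the coordinate frame, and [endo_derP] shows that it is a tensor. *)
Definition endo_der D A p v : 'M[R]_m :=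
  \matrix_(i, j) (D p v (fun q => A q *m E j p q) - A p *m D p v (E j p)) i 0.

Lemma endo_der_base D A p v j :
  endo_der D A p v *m std_basis R j = D p v (fun q => A q *m E j p q) - A p *m D p v (E j p).
Proof.
by apply/colP => i; rewrite -colE !mxE.
Qed.

(** The Leibniz terms of [D (A Y)] and of [A (D Y)] agree, hence their
    difference only depends on the value of [Y] at [p]. *)
Lemma endo_derP D A U W p v Y : open U -> smooth_endo U A -> open W -> W p -> W `<=` U ->
  smooth_field W Y ->
  D p v (fun q => A q *m Y q) - A p *m D p v Y = endo_der D A p v *m Y p.
Proof.
move=> oU sA oW0 W0p W0U sY0; pose W' := W `&` chart_domain p.
have oW : open W' by apply: openI => //; exact: open_chart_domain.
have Wp : W' p by split => //; exact: chart_at_dom.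
have WU : W' `<=` W by move=> q [].
have Wc : W' `<=` chart_domain p by move=> q [].
have sY := smooth_field_subset WU sY0.
have sAY := sA _ _ oW (subset_trans WU W0U) sY.
have sy i := smooth_entry i oW Wc sY.
have sE i : smooth_field W' (E i p) by exact: smooth_coord_fieldS.
have sAE i := sA _ _ oW (subset_trans WU W0U) (sE i).
have dY q : W' q -> Y q = \sum_i entry i (field_in (chart_at p) Y q) *: E i p q.
  by move=> [_ pq]; rewrite -field_decomp.
rewrite (@cov_local _ _ _ D W' Y _ p v oW Wp sY dY).
rewrite (@cov_local _ _ _ D W' _ (fun q => \sum_i entry i (field_in (chart_at p) Y q) *: (A q *m E i p q)) p v oW Wp sAY); last first.
  move=> q Wq; rewrite (dY q Wq) mulmx_sumr; apply: eq_bigr => i _.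
  by rewrite -scalemxAr.
rewrite (cov_expand D v _ oW Wp sy sE) (cov_expand D v _ oW Wp sy sAE).
rewrite [in RHS](dY p Wp) !mulmx_sumr -sumrB; apply: eq_bigr => i _.
rewrite coord_field_self -scalemxAr endo_der_base mulmxDr -!scalemxAr scalerBr.
by rewrite opprD addrACA subrr addr0.
Qed.

Lemma endo_der_linear D A U p : open U -> U p -> smooth_endo U A ->
  linear (endo_der D A p).
Proof.
move=> oU0 Up sA a u v; pose W := U `&` chart_domain p.
have oU : open W by apply: openI => //; exact: open_chart_domain.
have Wp : W p by split => //; exact: chart_at_dom.
have sE j : smooth_field W (E j p) by apply: smooth_coord_fieldS => q [].
have sAE j : smooth_field W (fun q => A q *m E j p q) by apply: sA => // q [].
apply/matrixP => i j; rewrite [LHS]mxE (cov_linear D a u v oU Wp (sAE j)).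
rewrite (cov_linear D a u v oU Wp (sE j)) mulmxDr -scalemxAr !mxE; ring.
Qed.

Lemma endo_der_eq D A A' U p v : open U -> U p -> smooth_endo U A ->
  (forall q, U q -> A q = A' q) -> endo_der D A p v = endo_der D A' p v.
Proof.
move=> oU0 Up sA AA; pose W := U `&` chart_domain p.
have oU : open W by apply: openI => //; exact: open_chart_domain.
have Wp : W p by split => //; exact: chart_at_dom.
have sE j : smooth_field W (E j p) by apply: smooth_coord_fieldS => q [].
have sAE j : smooth_field W (fun q => A q *m E j p q) by apply: sA => // q [].
apply/matrixP => i j; rewrite !mxE (AA p Up).
rewrite (@cov_local _ _ _ D W _ (fun q => A' q *m E j p q) p v oU Wp (sAE j)) //.
by move=> q [Uq _]; rewrite AA.
Qed.

Lemma endo_der_comb D U p v (x : 'I_3 -> M -> R^o) (J : 'I_3 -> M -> 'M[R]_m) :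
  open U -> U p -> (forall a, smooth_fun U (x a)) -> (forall a, smooth_endo U (J a)) ->
  endo_der D (fun q => \sum_a x a q *: J a q) p v =
  \sum_a (vder p v (x a) *: J a p + x a p *: endo_der D (J a) p v).
Proof.
move=> oU0 Up sx0 sJ; pose W := U `&` chart_domain p.
have oU : open W by apply: openI => //; exact: open_chart_domain.
have WU : W `<=` U by move=> q [].
have Wp : W p by split => //; exact: chart_at_dom.
have sx a := smooth_fun_subset WU (sx0 a).
have sE j : smooth_field W (E j p) by apply: smooth_coord_fieldS => q [].
have sAE j a : smooth_field W (fun q => J a q *m E j p q) by apply: sJ.
apply/matrixP => i j; rewrite mxE.
have -> : (fun q => (\sum_a x a q *: J a q) *m E j p q) =
   fun q => \sum_a x a q *: (J a q *m E j p q).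
  apply/funext => q; rewrite mulmx_suml; apply: eq_bigr => a _.
  by rewrite scalemxAl.
rewrite (cov_expand D v _ oU Wp sx (sAE j)) mulmx_suml -sumrB !summxE.
apply: eq_bigr => a _; rewrite coord_field_self -scalemxAl {2}/std_basis -colE !mxE.
ring.
Qed.

(** Differentiate [A A Y = - Y]: the derivative of an almost complex structure
    anticommutes with it. *)
Lemma endo_der_sqr D U p v A : open U -> U p -> smooth_endo U A ->
  (forall q, U q -> A q *m A q = - 1%:M) ->
  endo_der D A p v *m A p = - (A p *m endo_der D A p v).
Proof.
move=> oU0 Up sA AA; pose W := U `&` chart_domain p.
have oU : open W by apply: openI => //; exact: open_chart_domain.
have WU : W `<=` U by move=> q [].
have Wp : W p by split => //; exact: chart_at_dom.
apply: matrix_eq_mulv => u.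
have sE : smooth_field W (coord_field p u) by apply: smooth_coord_fieldS => q [].
have sAE := sA _ _ oU WU sE.
have h1 := endo_derP D v oU0 sA oU Wp WU sE.
have h2 := endo_derP D v oU0 sA oU Wp WU sAE.
rewrite coord_field_self in h1; rewrite coord_field_self in h2.
have h3 : D p v (fun q => A q *m (A q *m coord_field p u q)) = - D p v (coord_field p u).
  have sN := smooth_fieldZ oU (smooth_fun_cst W (-1)) sE.
  rewrite (@cov_local _ _ _ D W _ (fun q => (-1) *: coord_field p u q) p v oU Wp).
  - rewrite (cov_leibniz D v oU Wp (smooth_fun_cst W (-1)) sE).
    by rewrite vder_cst scale0r addr0 scaleN1r.
  - exact: sA.
  - by move=> q Wq; rewrite mulmxA AA ?mulNmx ?mul1mx ?scaleN1r//; exact: WU.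
rewrite -mulmxA -h2 h3 mulNmx -mulmxA -h1 mulmxBr mulmxA AA // mulNmx mul1mx.
by rewrite opprB addrC.
Qed.

Variable (g : metric M).

Lemma metricD p u v w : g p (u + v) w = g p u w + g p v w.
Proof. by have := metric_linear g p 1 u v w; rewrite scale1r mul1r. Qed.
Lemma metric0 p w : g p 0 w = 0.
Proof. by have := metric_linear g p (-1) 0 0 w; rewrite scaler0 addr0 mulN1r addNr. Qed.
Lemma metricZ p a u w : g p (a *: u) w = a * g p u w.
Proof. by have := metric_linear g p a u 0 w; rewrite metric0 !addr0. Qed.
Lemma metricN p u w : g p (- u) w = - g p u w.
Proof. by rewrite -scaleN1r metricZ mulN1r. Qed.
Lemma metricDr p u v w : g p w (u + v) = g p w u + g p w v.
Proof. by rewrite Defs.metric_sym metricD; congr (_ + _); exact: Defs.metric_sym. Qed.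
Lemma metricZr p a u w : g p w (a *: u) = a * g p w u.
Proof. by rewrite Defs.metric_sym metricZ; congr (_ * _); exact: Defs.metric_sym. Qed.
Lemma metricNr p u w : g p w (- u) = - g p w u.
Proof. by rewrite Defs.metric_sym metricN; congr (- _); exact: Defs.metric_sym. Qed.

Lemma metric_inj p u u' : (forall w, g p u w = g p u' w) -> u = u'.
Proof.
move=> H; apply/eqP; rewrite -subr_eq0; apply/negPn/negP => /(@metric_pos _ _ _ g p).
by rewrite metricD metricN H subrr ltxx.
Qed.

Lemma endo_der_skew D U p v A : metric_connection g D ->
  open U -> U p -> smooth_endo U A ->
  (forall q, U q -> forall u w, g q (A q *m u) w = - g q u (A q *m w)) ->
  forall u w, g p (endo_der D A p v *m u) w = - g p u (endo_der D A p v *m w).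
Proof.
move=> mD oU0 Up sA AA u w; pose W := U `&` chart_domain p.
have oU : open W by apply: openI => //; exact: open_chart_domain.
have WU : W `<=` U by move=> q [].
have Wp : W p by split => //; exact: chart_at_dom.
have sE u' : smooth_field W (coord_field p u') by apply: smooth_coord_fieldS => q [].
have sAE u' := sA _ _ oU WU (sE u').
have h u' := endo_derP D v oU0 sA oU Wp WU (sE u').
have hu := h u; have hw := h w; rewrite coord_field_self in hu; rewrite coord_field_self in hw.
have m1 := mD W _ _ p v oU Wp (sAE u) (sE w).
have m2 := mD W _ _ p v oU Wp (sE u) (sAE w).
have m0 := vderD v oU Wp (metric_smooth g oU (sAE u) (sE w)) (metric_smooth g oU (sE u) (sAE w)).
rewrite m1 m2 in m0; rewrite !coord_field_self in m0.
have z : vder p v (fun q => g q (A q *m coord_field p u q) (coord_field p w q) +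
       g q (coord_field p u q) (A q *m coord_field p w q) : R^o) = 0.
  rewrite -[RHS](vder_cst (W := R^o) p v 0); apply: (vder_eq v oU Wp) => q Wq.
  by rewrite AA ?addNr//; exact: WU.
rewrite z in m0; rewrite -hu -hw metricDr metricD metricNr metricN.
have a1 := AA p Up (D p v (coord_field p u)) w.
have a2 := AA p Up u (D p v (coord_field p w)).
lra.
Qed.

(** With [A = J a] this is the Kaehler form [kahler g J a]. *)
Definition endo_form (A : M -> 'M[R]_m) p (u v : V) : R := g p u (A p *m v).

Lemma vder_endo_form D U p A : metric_connection g D -> open U -> U p -> smooth_endo U A ->
  forall u v w,
  vder p u (fun q => endo_form A q (coord_field p v q) (coord_field p w q) : R^o) =
  g p (D p u (coord_field p v)) (A p *m w) + g p v (A p *m D p u (coord_field p w))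
  + g p v (endo_der D A p u *m w).
Proof.
move=> mD oU0 Up sA u v w; pose W := U `&` chart_domain p.
have oU : open W by apply: openI => //; exact: open_chart_domain.
have WU : W `<=` U by move=> q [].
have Wp : W p by split => //; exact: chart_at_dom.
have sE u' : smooth_field W (coord_field p u') by apply: smooth_coord_fieldS => q [].
have sAE u' := sA _ _ oU WU (sE u').
have hw := endo_derP D u oU0 sA oU Wp WU (sE w); rewrite coord_field_self in hw.
rewrite (mD W _ _ p u oU Wp (sE v) (sAE w)) !coord_field_self -hw.
rewrite metricDr metricNr; ring.
Qed.

Lemma cov2_endo_form D U p A : metric_connection g D -> open U -> U p -> smooth_endo U A ->
  forall u v w, cov2 D (endo_form A) p u v w = g p v (endo_der D A p u *m w).
Proof.
move=> mD oU Up sA u v w; rewrite /cov2 (vder_endo_form mD oU Up sA) /endo_form; ring.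
Qed.

Lemma torsion_coord D p u v : torsion D (coord_field p u) (coord_field p v) p =
  D p u (coord_field p v) - D p v (coord_field p u).
Proof. by rewrite /torsion lie_coord subr0 !coord_field_self. Qed.

Lemma torsion3E D p u v w : torsion3 g D p u v w =
  g p (D p u (coord_field p v)) w - g p (D p v (coord_field p u)) w.
Proof. by rewrite /torsion3 torsion_coord metricD metricN. Qed.

(** On coordinate fields the exterior derivative is a cyclic sum of partial
    derivatives; expanding them with a metric connection leaves the covariant
    derivative of [A] and the antisymmetrized Christoffel symbols, that is, the
    torsion. *)
Lemma d2_endo_form D U p A : metric_connection g D -> open U -> U p -> smooth_endo U A ->
  (forall q, U q -> forall u w, g q (A q *m u) w = - g q u (A q *m w)) ->
  forall u v w, d2 (endo_form A) p u v w =
  g p v (endo_der D A p u *m w) + g p w (endo_der D A p v *m u)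
  + g p u (endo_der D A p w *m v)
  + (torsion3 g D p u v (A p *m w) + torsion3 g D p v w (A p *m u)
     + torsion3 g D p w u (A p *m v)).
Proof.
move=> mD oU Up sA AA u v w.
have [Gam GamE] : exists Gam : V -> V -> V, forall x y, D p x (coord_field p y) = Gam x y.
  by eexists => x y; reflexivity.
have sk x y : g p x (A p *m y) = - g p y (A p *m x).
  by rewrite Defs.metric_sym (AA p Up).
have tk x y z : torsion3 g D p x y z = g p (Gam x y) z - g p (Gam y x) z.
  by rewrite torsion3E !GamE.
have vk x y z : vder p x (fun q => endo_form A q (coord_field p y q) (coord_field p z q) : R^o) =
  g p (Gam x y) (A p *m z) + g p y (A p *m Gam x z) + g p y (endo_der D A p x *m z).
  by rewrite (vder_endo_form mD oU Up sA) !GamE.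
rewrite /d2 /= !vk !tk (sk v (Gam u w)) (sk w (Gam v u)) (sk u (Gam w v)).
move: (endo_der D A p) (g p) (A p) => P G B; ring.
Qed.

End Connections.

(** * Quaternionic triples, 3-forms and traces *)

Section Algebra.
Variables (R : realType) (m : nat).
Local Notation V := 'cV[R]_m.
Implicit Types (G : V -> V -> R) (I J K : 'M[R]_m) (T : V -> V -> V -> R).

Record inner G : Prop := Inner {
  innerD : forall u v w, G (u + v) w = G u w + G v w;
  innerZ : forall a u w, G (a *: u) w = a * G u w;
  innerC : forall u v, G u v = G v u }.

Lemma innerN G (iG : inner G) u v : G (- u) v = - G u v.
Proof. by rewrite -scaleN1r innerZ // mulN1r. Qed.
Lemma innerNr G (iG : inner G) u v : G u (- v) = - G u v.
Proof. by rewrite innerC // innerN // innerC. Qed.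

(** Composition and hermitian rules of an admissible basis, in a form suited to
    rewriting. [I], [J], [K] stand for [J_a], [J_b], [J_c] with [(a, b, c)] cyclic. *)
Record quat_triple G I J K : Prop := QuatTriple {
  triple_inner : inner G;
  tII : forall u : V, I *m (I *m u) = - u;
  tJJ : forall u : V, J *m (J *m u) = - u;
  tKK : forall u : V, K *m (K *m u) = - u;
  tIJ : forall u : V, I *m (J *m u) = K *m u;
  tJI : forall u : V, J *m (I *m u) = - (K *m u);
  tJK : forall u : V, J *m (K *m u) = I *m u;
  tKJ : forall u : V, K *m (J *m u) = - (I *m u);
  tKI : forall u : V, K *m (I *m u) = J *m u;
  tIK : forall u : V, I *m (K *m u) = - (J *m u);
  tGI : forall u v, G (I *m u) v = - G u (I *m v);
  tGJ : forall u v, G (J *m u) v = - G u (J *m v);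
  tGK : forall u v, G (K *m u) v = - G u (K *m v) }.

(** Moves every structure to the right argument of the metric and reduces words
    in [I], [J], [K]; identities between forms then become linear arithmetic. *)
Definition quaternion_rules G I J K (t : quat_triple G I J K) :=
  (tII t, tJJ t, tKK t, tIJ t, tJI t, tJK t, tKJ t, tKI t, tIK t, tGI t, tGJ t, tGK t,
   innerN (triple_inner t), innerNr (triple_inner t), @mulmxN R m m 1, @opprK R, @opprK V).

Lemma quat_triple_rot G I J K : quat_triple G I J K -> quat_triple G J K I.
Proof. by case=> *; constructor. Qed.

Record odd3 T : Prop := Odd3 {
  od1 : forall u v w, T (- u) v w = - T u v w;
  od2 : forall u v w, T u (- v) w = - T u v w;
  od3 : forall u v w, T u v (- w) = - T u v w }.

Record skew3 T : Prop := Skew3 {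
  sk12 : forall u v w, T u v w = - T v u w;
  sk23 : forall u v w, T u v w = - T u w v }.

Lemma rot3 T : skew3 T -> forall u v w, T u v w = T v w u.
Proof. by move=> sT u v w; rewrite (sk12 sT) (sk23 sT) opprK. Qed.

Definition cyclic_sum T u v w := T u v w + T v w u + T w u v.

Section Plus.
Variables (G : V -> V -> R) (I J K : 'M[R]_m) (tr : quat_triple G I J K).
Local Notation FJ := (fun u v => G u (J *m v)).
Local Notation FK := (fun u v => G u (K *m v)).

Let iG := triple_inner tr.
Let qw := quaternion_rules tr.

(** The summand is the Levi-Civita derivative [g(v, (Dg_u I) w)] when the metric
    connection with torsion [T] differentiates [I] into [y K + z J]; the cyclic sum
    is then the exterior derivative of the Kaehler form of [I]. *)
Lemma cyclic_sum_formula T (y z : V -> R) : skew3 T -> forall u v w,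
  cyclic_sum (fun u v w => y u * G v (K *m w) + z u * G v (J *m w) +
                   2^-1 * (T u v (I *m w) + T u (I *m v) w)) u v w =
  wedge12 y FK u v w + wedge12 z FJ u v w +
  (T (I *m u) v w + T u (I *m v) w + T u v (I *m w)).
Proof.
move=> sT u v w; rewrite /cyclic_sum /wedge12 /=.
rewrite -(rot3 sT (I *m u) v w) -(rot3 sT u v (I *m w)).
rewrite (rot3 sT w u (I *m v)) (rot3 sT w (I *m u) v).
by field.
Qed.

Lemma type_III T : odd3 T -> type12_21 I T -> forall u v w,
  T (I *m u) v w + T u (I *m v) w + T u v (I *m w) = T (I *m u) (I *m v) (I *m w).
Proof.
by move=> oT tT u v w; rewrite (tT (I *m u)) !qw !(od1 oT, od2 oT, od3 oT, opprK); ring.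
Qed.

Variables (T : V -> V -> V -> R) (y z : V -> R).
Hypotheses (oT : odd3 T) (sT : skew3 T) (tT : type12_21 I T).
Hypotheses (oy : forall u, y (- u) = - y u) (oz : forall u, z (- u) = - z u).
Let oo := (od1 oT, od2 oT, od3 oT, oy, oz, @mulNr R, @mulrN R, @opprK R).
Let dF := cyclic_sum (fun u v w => y u * G v (K *m w) + z u * G v (J *m w) +
                   2^-1 * (T u v (I *m w) + T u (I *m v) w)).
Let kap u := - y u + z (I *m u).

Lemma dF_formula u v w : dF u v w =
  wedge12 y FK u v w + wedge12 z FJ u v w + T (I *m u) (I *m v) (I *m w).
Proof. by rewrite /dF cyclic_sum_formula // type_III. Qed.

(** A form of type (1,2)+(2,1) is unchanged by the projection, while the
    projection of [psi] wedge [F_K] mixes it with [(I psi)] wedge [F_J]. Hence [y]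
    and [z] only enter through the 1-form [kap]. *)
Lemma dplus_formula u v w : part12_21 I dF u v w =
    T (I *m u) (I *m v) (I *m w) +
      2^-1 * (wedge12 (J1form I kap) FJ u v w - wedge12 kap FK u v w).
Proof.
have := tT (I *m u) (I *m v) (I *m w).
rewrite /part12_21 !dF_formula /wedge12 /J1form /kap /= !qw !oo => h.
lra.
Qed.

Lemma dsubplus_formula u v w :
  part12_21 I (fun u v w => - dF (I *m u) (I *m v) (I *m w)) u v w =
    T u v w + 2^-1 * (wedge12 (J1form I kap) FK u v w + wedge12 kap FJ u v w).
Proof.
have := tT u v w.
rewrite /part12_21 !dF_formula /wedge12 /J1form /kap /= !qw !oo => h.
lra.
Qed.
End Plus.

Definition lin1 (psi : V -> R) := forall a u v, psi (a *: u + v) = a * psi u + psi v.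

Lemma lin1D psi : lin1 psi -> forall u v, psi (u + v) = psi u + psi v.
Proof. by move=> l u v; have := l 1 u v; rewrite scale1r mul1r. Qed.
Lemma lin1_0 psi : lin1 psi -> psi 0 = 0.
Proof. by move=> l; have := l (-1) 0 0; rewrite scaler0 addr0 mulN1r addNr. Qed.
Lemma lin1Z psi : lin1 psi -> forall a u, psi (a *: u) = a * psi u.
Proof. by move=> l a u; have := l a u 0; rewrite (lin1_0 l) !addr0. Qed.
Lemma lin1N psi : lin1 psi -> forall u, psi (- u) = - psi u.
Proof. by move=> l u; rewrite -scaleN1r lin1Z // mulN1r. Qed.
Lemma lin1_sum psi : lin1 psi -> forall (X : Type) (r : seq X) (F : X -> V),
  psi (\sum_(i <- r) F i) = \sum_(i <- r) psi (F i).
Proof.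
move=> l X r F; elim: r => [|i r IH]; first by rewrite !big_nil lin1_0.
by rewrite !big_cons lin1D // IH.
Qed.

Record lin2 (b : V -> V -> R) : Prop := Lin2 {
  l2l : forall v, lin1 (fun u => b u v);
  l2r : forall u, lin1 (b u) }.

Record lin3 T : Prop := Lin3 {
  l31 : forall v w, lin1 (fun u => T u v w);
  l32 : forall u w, lin1 (fun v => T u v w);
  l33 : forall u v, lin1 (T u v) }.

Lemma lin3_odd T : lin3 T -> odd3 T.
Proof.
by move=> l; split=> u v w; [rewrite (lin1N (l31 l v w))|rewrite (lin1N (l32 l u w))|
  rewrite (lin1N (l33 l u v))].
Qed.

Lemma inner_lin2 G : inner G -> lin2 G.
Proof.
move=> iG; have l v : lin1 (fun u => G u v) by move=> a x y; rewrite innerD // innerZ.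
by split=> // u a x y; rewrite !(innerC iG u) l.
Qed.

Section Trace.
Variables (G : V -> V -> R) (iG : inner G) (e : 'I_m -> V).
Hypothesis eo : forall i j, G (e i) (e j) = (i == j)%:R.

(** An orthonormal family of [m] vectors is a basis: its matrix has the matrix
    of the coordinates [G (e i)] as a left inverse, hence as an inverse. *)
Lemma ortho_expand X : X = \sum_i G (e i) X *: e i.
Proof.
have l2 := inner_lin2 iG.
pose A : 'M[R]_m := \matrix_(i, j) G (e i) (std_basis R j).
pose P : 'M[R]_m := \matrix_(i, j) e j i 0.
have AX (Y : V) i : (A *m Y) i 0 = G (e i) Y.
  rewrite {2}[Y]cV_decomp (lin1_sum (l2r l2 (e i))) mxE; apply: eq_bigr => j _.
  by rewrite (lin1Z (l2r l2 (e i))) mxE mulrC.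
have PX (c : V) : P *m c = \sum_i c i 0 *: e i.
  apply/colP => i; rewrite summxE mxE; apply: eq_bigr => j _.
  by rewrite !mxE mulrC.
have AP : A *m P = 1%:M.
  apply/matrixP => i j; rewrite mxE -[RHS](_ : G (e i) (e j) = _) ?eo ?mxE // -eo -AX mxE.
  by apply: eq_bigr => k _; rewrite !mxE.
rewrite -[LHS]mul1mx -(mulmx1C AP) -mulmxA PX; apply: eq_bigr => i _.
by rewrite AX.
Qed.

Lemma trace_eval psi X : lin1 psi -> \sum_i psi (e i) * G (e i) X = psi X.
Proof.
move=> l; rewrite [in RHS](ortho_expand X) (lin1_sum l); apply: eq_bigr => i _.
by rewrite (lin1Z l) mulrC.
Qed.

(** Metric traces may be computed in any pair of dual families; this gives both
    the invariance under orthogonal maps and the smoothness of traces. *)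
Lemma trace_dual (b : V -> V -> R) (f f' : 'I_m -> V) : lin2 b ->
  (forall X, X = \sum_j G X (f' j) *: f j) ->
  \sum_i b (e i) (e i) = \sum_j b (f j) (f' j).
Proof.
move=> lb ff.
under eq_bigr => i _.
  rewrite {1}(ff (e i)) (lin1_sum (l2l lb (e i))).
  under eq_bigr => j _ do rewrite (lin1Z (l2l lb (e i))).
  over.
rewrite exchange_big; apply: eq_bigr => j _ /=.
rewrite -[RHS](trace_eval (f' j) (l2r lb (f j))); apply: eq_bigr => i _.
by rewrite mulrC.
Qed.
End Trace.

Lemma trace_inv G (e : 'I_m -> V) (A : 'M[R]_m) b : inner G -> lin2 b ->
  (forall i j, G (e i) (e j) = (i == j)%:R) ->
  (forall u : V, A *m (A *m u) = - u) -> (forall u v, G (A *m u) v = - G u (A *m v)) ->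
  \sum_i b (A *m e i) (A *m e i) = \sum_i b (e i) (e i).
Proof.
move=> iG lb eo AA Ag; symmetry; apply: (trace_dual iG eo lb) => X.
have eo' i j : G (A *m e i) (A *m e j) = (i == j)%:R by rewrite Ag AA innerNr // opprK eo.
rewrite {1}(ortho_expand iG eo' X); apply: eq_bigr => i _; by rewrite innerC.
Qed.

Section Forward.
Variables (G : V -> V -> R) (I J K : 'M[R]_m) (tr : quat_triple G I J K) (e : 'I_m -> V).
Hypothesis eo : forall i j, G (e i) (e j) = (i == j)%:R.
Let iG := triple_inner tr.
Let l2 := inner_lin2 iG.
Let Gl v : lin1 (fun u => G u v) := l2l l2 v.
Let qw := quaternion_rules tr.

Definition lee1_of (Eg : V -> V -> V -> R) u := - \sum_i Eg (e i) (e i) (I *m u).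
Definition lee2_of (Eg : V -> V -> V -> R) u :=
  - 2^-1 * \sum_i part12_21 I (cyclic_sum Eg) u (e i) (K *m e i).
Definition lee_K (n : nat) Eg u := (1 - n%:R)^-1 * (J1form J (lee1_of Eg) u + lee2_of Eg u).

Variables (T : V -> V -> V -> R) (y z : V -> R).
Hypotheses (lT : lin3 T) (sT : skew3 T) (tT : type12_21 I T) (tTJ : type12_21 J T).
Hypotheses (ly : lin1 y) (lz : lin1 z).
Let oT := lin3_odd lT.
Let oy := lin1N ly.
Let oz := lin1N lz.
Let Eg u v w := y u * G v (K *m w) + z u * G v (J *m w) +
                   2^-1 * (T u v (I *m w) + T u (I *m v) w).
Let kap u := - y u + z (I *m u).
Let S (A : 'M[R]_m) x := \sum_i T x (e i) (A *m e i).

Lemma lin1_mulmx (psi : V -> R) (A : 'M[R]_m) : lin1 psi -> lin1 (fun u => psi (A *m u)).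
Proof. by move=> l a u v; rewrite mulmxDr -scalemxAr l. Qed.

Lemma T_lin2 x (A : 'M[R]_m) : lin2 (fun u v => T x u (A *m v)).
Proof.
split => [v|u]; first exact: l32.
exact: (lin1_mulmx A (l33 lT x u)).
Qed.

Let lkap : lin1 kap.
Proof. move=> a u v; rewrite /kap ly mulmxDr -scalemxAr lz; ring. Qed.

(** Apply the type condition for [J] to [T(K u, e, I e)] and sum over [e]. Replacing
    the basis [e] by [J e] turns the three terms into the two traces. *)
Lemma trace_relation u : S I (K *m u) = - S K (I *m u).
Proof.
have e1 : S I (K *m u) = - S K (I *m u) - S K (I *m u) - S I (K *m u).
  rewrite {1}/S; under eq_bigr => i _.
    rewrite (tTJ (K *m u) (e i) (I *m e i)).
    rewrite (_ : T (J *m (K *m u)) (J *m e i) (I *m e i) =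
       - T (I *m u) (J *m e i) (K *m (J *m e i))); last by rewrite !qw (od3 oT) opprK.
    rewrite (_ : T (J *m (K *m u)) (e i) (J *m (I *m e i)) =
       - T (I *m u) (e i) (K *m e i)); last by rewrite !qw (od3 oT).
    rewrite (_ : T (K *m u) (J *m e i) (J *m (I *m e i)) =
       - T (K *m u) (J *m e i) (I *m (J *m e i))); last by rewrite !qw (od3 oT).
    over.
  rewrite !big_split /= !sumrN.
  rewrite (trace_inv iG (T_lin2 (I *m u) K) eo (tJJ tr) (tGJ tr)).
  by rewrite (trace_inv iG (T_lin2 (K *m u) I) eo (tJJ tr) (tGJ tr)).
lra.
Qed.

Lemma lee1_formula x : lee1_of Eg x = kap (J *m x) - 2^-1 * S I (I *m x).
Proof.
rewrite /lee1_of /Eg.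
have -> : \sum_i (y (e i) * G (e i) (K *m (I *m x)) + z (e i) * G (e i) (J *m (I *m x)) +
    2^-1 * (T (e i) (e i) (I *m (I *m x)) + T (e i) (I *m e i) (I *m x))) =
  \sum_i y (e i) * G (e i) (K *m (I *m x)) + \sum_i z (e i) * G (e i) (J *m (I *m x)) +
   2^-1 * S I (I *m x).
  rewrite /S mulr_sumr -!big_split /=; apply: eq_bigr => i _.
  have -> : T (e i) (e i) (I *m (I *m x)) = 0.
    by have := sk12 sT (e i) (e i) (I *m (I *m x)); lra.
  by rewrite add0r (rot3 sT (I *m x)).
rewrite (trace_eval iG eo _ ly) (trace_eval iG eo _ lz) /kap !qw oz; ring.
Qed.

Hypothesis (n : nat) (mn : m = (4 * n)%N) (n1 : (1 < n)%N).

Lemma lee2_formula x : lee2_of Eg x = 2^-1 * S K (I *m x) - n%:R * kap x.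
Proof.
(* The only trace that sees the dimension: it produces the factor [n]. *)
have trG : \sum_i G (e i) (e i) = 4 * n%:R.
  under eq_bigr => i _ do rewrite eo eqxx.
  by rewrite sumr_const card_ord mn -natrM.
rewrite /lee2_of.
have -> : \sum_i part12_21 I (cyclic_sum Eg) x (e i) (K *m e i) =
  - (\sum_i T (I *m x) (I *m e i) (K *m (I *m e i))) +
  2^-1 * (\sum_i J1form I kap (e i) * G (e i) (I *m x) +
    \sum_i kap (J *m e i) * G (J *m e i) x
    + kap x * \sum_i G (e i) (e i) - \sum_i kap (e i) * G (e i) x
    - \sum_i kap (K *m e i) * G (K *m e i) x).
  rewrite -!sumrN mulr_sumr -!big_split /= mulr_sumr -!big_split /=.
  apply: eq_bigr => i _.
  rewrite (dplus_formula tr y oT sT tT oz) -/kap /wedge12 /J1form.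
  have kN := lin1N lkap.
  rewrite !(innerC iG x) !qw !(od3 oT) !kN.
  have -> : G (e i) (I *m e i) = 0.
    by have := tGI tr (e i) (e i); rewrite innerC //; lra.
  rewrite !(innerC iG _ x) !qw; ring.
rewrite (trace_inv iG (T_lin2 (I *m x) K) eo (tII tr) (tGI tr)).
have lb : lin2 (fun u v => kap u * G v x).
  split => [v a u w|u a v w] /=; first by rewrite lkap; ring.
  by rewrite (Gl x) ; ring.
rewrite (trace_inv iG lb eo (tJJ tr) (tGJ tr)).
rewrite (trace_inv iG lb eo (tKK tr) (tGK tr)).
have lI : lin1 (J1form I kap).
  by move=> a u v; rewrite /J1form mulmxDr -scalemxAr lkap; ring.
rewrite (trace_eval iG eo _ lkap) (trace_eval iG eo _ lI) trG -/(S K (I *m x)).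
rewrite /J1form (tII tr) (lin1N lkap); by field.
Qed.

(** In [lee1_of] and [lee2_of] the traces of [T] appear as [S I (K u)] and
    [S K (I u)], which cancel by [trace_relation]; what is left is
    [(1 - n) kap]. *)
Lemma lee_K_formula u : lee_K n Eg u = kap u.
Proof.
have n0 : 1 - n%:R != 0 :> R.
  by rewrite subr_eq0 eq_sym -[1]/(1%:R) eqr_nat; case: n n1 => [|[]].
rewrite /lee_K /J1form lee1_formula lee2_formula.
rewrite (tIJ tr) (tJJ tr) trace_relation (lin1N lkap).
by field.
Qed.

(** The (1,2)+(2,1) part of [d_I F_I] is [T] plus wedge products with [kap],
    and [kap] is the Lee combination [lee_K]: the torsion is determined by the
    metric and the basis. *)
Lemma torsion_formula u v w : T u v w =
  part12_21 I (fun u v w => - cyclic_sum Eg (I *m u) (I *m v) (I *m w)) u v w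
  - 2^-1 * (wedge12 (J1form I (lee_K n Eg)) (fun u v => G u (K *m v)) u v w +
            wedge12 (lee_K n Eg) (fun u v => G u (J *m v)) u v w).
Proof.
have -> : lee_K n Eg = kap by apply/funext => x; exact: lee_K_formula.
rewrite (dsubplus_formula tr oT sT tT oy oz) -/kap; by field.
Qed.
End Forward.
End Algebra.

(** * Recovering the derivative of a complex structure *)

Section Backward.
Variables (R : realType) (m : nat).
Local Notation V := 'cV[R]_m.
Variables (G : V -> V -> R) (I J K : 'M[R]_m) (tr : quat_triple G I J K).
Implicit Types (T E : V -> V -> V -> R).

Let iG := triple_inner tr.
Let qw := quaternion_rules tr.

(** If [E u v w = G v (X_u w)] with [X_u] the derivative of [I] for a torsion-free
    connection, this is the Nijenhuis tensor of [I] paired with [W]. *)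
Definition nijenhuis E W Y Z : R :=
  E (I *m Y) W Z - E (I *m Z) W Y + E Y (I *m W) Z - E Z (I *m W) Y.

(** The derivative of an almost hermitian structure is determined by its
    Nijenhuis tensor and by the (1,2)+(2,1) part of [dF], the
    cyclic sum of [E]. Indeed
    [dF(u,v,w) - dF(u,Iv,Iw)] equals [2 E(u;v,w)] up to a Nijenhuis term; summing
    cyclically shows that the (3,0)+(0,3) part of [dF] is also governed by the
    Nijenhuis tensor, so [dF] vanishes and then [E] does. *)
Lemma nablaF_eq0 E : odd3 E ->
  (forall u v w, E u w v = - E u v w) ->
  (forall u v w, E u (I *m v) (I *m w) = - E u v w) ->
  (forall W Y Z, nijenhuis E W Y Z = 0) ->
  (forall u v w, part12_21 I (cyclic_sum E) u v w = 0) ->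
  forall u v w, E u v w = 0.
Proof.
move=> oE sE aE NE pE.
have h u v w : cyclic_sum E u v w - cyclic_sum E u (I *m v) (I *m w) = 2 * E u v w.
  have := NE (I *m u) v w; rewrite /nijenhuis /cyclic_sum !(tII tr) !(od2 oE).
  have a1 := aE (I *m v) (I *m w) u; have a2 := aE (I *m w) u (I *m v).
  rewrite !(tII tr) in a1 a2; rewrite (od2 oE) in a1; rewrite (od3 oE) in a2.
  have b1 := sE (I *m v) (I *m u) w. have b2 := sE w u v.
  have b3 := sE v u w.
  rewrite aE.
  lra.
have cs u v w : cyclic_sum E v w u = cyclic_sum E u v w by rewrite /cyclic_sum; ring.
have z u v w : cyclic_sum E u v w = 0.
  have := pE u v w; have h1 := h u v w; have h2 := h v w u; have h3 := h w u v.
  rewrite /part12_21.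
  have e1 : 2 * (E u v w + E v w u + E w u v) = 2 * cyclic_sum E u v w by [].
  have c2 := cs u v w; have c3 := cs w u v.
  have c4 := cs (I *m u) v (I *m w); have c5 := cs w (I *m u) (I *m v).
  rewrite /cyclic_sum in e1 h1 h2 h3 c2 c3 c4 c5 *; lra.
by move=> u v w; have := h u v w; rewrite !z; lra.
Qed.

(** Up to the symmetries of [T] the terms are those of the type condition: a
    torsion of type (1,2)+(2,1) does not contribute to the Nijenhuis tensor. *)
Lemma nijenhuis_torsion T W Y Z : odd3 T -> skew3 T -> type12_21 I T ->
  nijenhuis (fun u v w => 2^-1 * (T u v (I *m w) + T u (I *m v) w)) W Y Z = 0.
Proof.
move=> oT sT tT; rewrite /nijenhuis !(tII tr) !(od2 oT).
have := tT Y W Z.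
have sw a b c : T c b a = - T a b c.
  by rewrite (sk12 sT) (sk23 sT) (sk12 sT) opprK.
rewrite (sw (I *m Y) W (I *m Z)) (sw Y (I *m W) (I *m Z)) (sw Y W Z) (sw (I *m Y) (I *m W) Z).
lra.
Qed.

(** The commutator of [I] with a symmetric tensor is the change of the
    derivative of [I] between two torsion-free connections, and the Nijenhuis
    tensor does not see it. *)
Lemma nijenhuis_sym H W Y Z : odd3 H -> (forall u v w, H u v w = H w v u) ->
  nijenhuis (fun u v w => H u v (I *m w) + H u (I *m v) w) W Y Z = 0.
Proof.
move=> oH sH; rewrite /nijenhuis !(tII tr) !(od2 oH).
rewrite (sH (I *m Z) W) (sH (I *m Z) (I *m W)) (sH Z W) (sH Z (I *m W)); ring.
Qed.

(** When the derivative of [I] is [y K + z J], the Nijenhuis tensor only knows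
    the 1-form [y + z o I]. *)
Lemma nijenhuis_Q y z W Y Z : (forall u, z (- u) = - z u) -> (forall u, y (- u) = - y u) ->
  let b u := y u + z (I *m u) in
  nijenhuis (fun u v w => y u * G v (K *m w) + z u * G v (J *m w)) W Y Z =
  b (I *m Y) * G W (K *m Z) + b Y * G W (J *m Z)
  - b (I *m Z) * G W (K *m Y) - b Z * G W (J *m Y).
Proof.
by move=> oz oy; rewrite /nijenhuis /= !qw oz oz; ring.
Qed.

Lemma torsion_formula_type (S : V -> V -> V -> R) kap : odd3 S -> (forall u, kap (- u) = - kap u) ->
  type12_21 I (fun u v w => part12_21 I S u v w
    - 2^-1 * (wedge12 (J1form I kap) (fun u v => G u (K *m v)) u v w +
              wedge12 kap (fun u v => G u (J *m v)) u v w)).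
Proof.
move=> oS ok u v w; rewrite /part12_21 /wedge12 /J1form /=.
rewrite !qw !(od1 oS, od2 oS, od3 oS, ok, @mulNr R, @mulrN R, @opprK R).
by field.
Qed.

Lemma odd3_cyclic_sum E : odd3 E -> odd3 (cyclic_sum E).
Proof. by move=> oE; split=> u v w; rewrite /cyclic_sum !(od1 oE, od2 oE, od3 oE); ring. Qed.

(** Let [T] be given by the torsion formula for a 1-form [kap], and suppose that
    some torsion-free connection, differing from Levi-Civita by the tensor [H],
    differentiates [I] into the span of [J] and [K]. That connection prescribes
    the Nijenhuis tensor through [b = yq + zq o I], and the torsion formula
    prescribes the (1,2)+(2,1) part of [dF] through [kap]. The 1-forms [y] and [z]
    are chosen to give the same two invariants, so by [nablaF_eq0] the connection
    with torsion [T] differentiates [I] into [y K + z J]. *)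
Lemma nablaF_of_torsion_formula Eg T kap (yq zq : V -> R) H :
  lin3 Eg -> (forall u v w, Eg u w v = - Eg u v w) ->
  (forall u v w, Eg u (I *m v) (I *m w) = - Eg u v w) ->
  odd3 T -> skew3 T -> lin1 kap -> lin1 yq -> lin1 zq ->
  odd3 H -> (forall u v w, H u v w = H w v u) ->
  (forall u v w, Eg u v w + (H u v (I *m w) + H u (I *m v) w) =
     yq u * G v (K *m w) + zq u * G v (J *m w)) ->
  (forall u v w, T u v w =
    part12_21 I (fun u v w => - cyclic_sum Eg (I *m u) (I *m v) (I *m w)) u v w
    - 2^-1 * (wedge12 (J1form I kap) (fun u v => G u (K *m v)) u v w +
              wedge12 kap (fun u v => G u (J *m v)) u v w)) ->
  exists y z, [/\ lin1 y, lin1 z & forall u v w, Eg u v w =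
    y u * G v (K *m w) + z u * G v (J *m w) + 2^-1 * (T u v (I *m w) + T u (I *m v) w)].
Proof.
move=> lE sE aE oT sT lk ly lz oH sH RH TE.
have oE := lin3_odd lE; have oc := odd3_cyclic_sum oE.
have okk := lin1N lk; have oyy := lin1N ly; have ozz := lin1N lz.
have tT : type12_21 I T.
  have oc' : odd3 (fun u v w => - cyclic_sum Eg (I *m u) (I *m v) (I *m w)).
    by split => u v w; rewrite !mulmxN !(od1 oc, od2 oc, od3 oc).
  by move=> u v w; rewrite !TE (torsion_formula_type oc' okk).
pose b u := yq u + zq (I *m u).
(* [y] and [z] solve [y + z o I = b] and [- y + z o I = kap]. *)
pose y u := 2^-1 * (b u - kap u); pose z u := - 2^-1 * (b (I *m u) + kap (I *m u)).
have lb : lin1 b by move=> a u v; rewrite /b ly mulmxDr -scalemxAr lz; ring.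
have ly' : lin1 y by move=> a u v; rewrite /y lb lk; ring.
have lz' : lin1 z by move=> a u v; rewrite /z mulmxDr -scalemxAr lb lk; ring.
have oy := lin1N ly'; have oz := lin1N lz'; have ob := lin1N lb.
have zI u : z (I *m u) = 2^-1 * (b u + kap u) by rewrite /z (tII tr) ob okk; ring.
exists y, z; split => // u v w.
pose E1 u v w := y u * G v (K *m w) + z u * G v (J *m w).
pose E2 u v w := 2^-1 * (T u v (I *m w) + T u (I *m v) w).
pose E u v w := Eg u v w - (E1 u v w + E2 u v w).
apply/eqP; rewrite -subr_eq0 -/(E1 u v w) -/(E2 u v w) -/(E u v w); apply/eqP.
apply: nablaF_eq0 => {u v w}.
- split=> u v w; rewrite /E /E1 /E2 !(od1 oE, od2 oE, od3 oE, od1 oT, od2 oT, od3 oT, oy, oz,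
    @mulmxN R m m 1, innerN iG, innerNr iG); ring.
- move=> u v w; rewrite /E /E1 /E2 sE (sk23 sT u w) (sk23 sT u (I *m w)).
  have sk x x' A : (forall u v, G (A *m u) v = - G u (A *m v)) ->
     G x' (A *m x) = - G x (A *m x').
    by move=> gA; rewrite innerC // gA.
  rewrite (sk v w K (tGK tr)) (sk v w J (tGJ tr)); ring.
- move=> u v w; rewrite /E /E1 /E2 aE !qw !(od2 oT, od3 oT); ring.
- move=> W Y Z.
  have -> : nijenhuis E W Y Z = nijenhuis Eg W Y Z - nijenhuis E1 W Y Z - nijenhuis E2 W Y Z.
    by rewrite /nijenhuis /E; ring.
  rewrite (nijenhuis_torsion W Y Z oT sT tT).
  have -> : nijenhuis Eg W Y Z = nijenhuis (fun u v w => yq u * G v (K *m w) + zq u * G v (J *m w)) W Y Z.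
    have := nijenhuis_sym W Y Z oH sH; rewrite /nijenhuis -!RH; lra.
  rewrite !nijenhuis_Q // /b.
  have e1 u : y u + z (I *m u) = yq u + zq (I *m u).
    by rewrite zI /y /b; field.
  rewrite !e1; ring.
- move=> u v w.
  have c u' v' w' : cyclic_sum E u' v' w' = cyclic_sum Eg u' v' w' - cyclic_sum (fun u v w => E1 u v w + E2 u v w) u' v' w'.
    by rewrite /cyclic_sum /E; ring.
  have -> : part12_21 I (cyclic_sum E) u v w = part12_21 I (cyclic_sum Eg) u v w -
     part12_21 I (cyclic_sum (fun u v w => E1 u v w + E2 u v w)) u v w.
    by rewrite /part12_21 !c; ring.
  rewrite (dplus_formula tr y oT sT tT oz).
  have ek : (fun u => - y u + z (I *m u)) = kap.
    by apply/funext => x; rewrite zI /y; field.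
  rewrite ek (TE (I *m u)) /part12_21 /wedge12 /J1form /= !qw.
  rewrite !(od1 oc, od2 oc, od3 oc, okk, @mulNr R, @mulrN R, @opprK R).
  by field.
Qed.

(** The type conditions for the three structures, evaluated at [(u, Kv, w)] for
    [J], [(Ju, Kv, Jw)] for [K] and [(Iu, Kv, Iw)] for [I], add up to this
    polarized condition. *)
Lemma type_mixed T : odd3 T -> type12_21 I T -> type12_21 J T -> type12_21 K T ->
  forall u v w,
  T (I *m u) (J *m v) w + T (J *m u) (I *m v) w + T (I *m u) v (J *m w) +
  T (J *m u) v (I *m w) + T u (I *m v) (J *m w) + T u (J *m v) (I *m w) = 0.
Proof.
move=> oT tI tJ tK u v w.
have := tJ u (K *m v) w; have := tK (J *m u) (K *m v) (J *m w).
have := tI (I *m u) (K *m v) (I *m w).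
rewrite !qw !(od1 oT, od2 oT, od3 oT, @opprK R).
lra.
Qed.

End Backward.

(** The type condition is quadratic in the structure; its mixed terms vanish by
    [type_mixed], hence it passes to every unit combination. *)
Lemma type_comb (R : realType) (m : nat) (G : 'cV[R]_m -> 'cV[R]_m -> R) I J K T (x y z : R) :
  quat_triple G I J K ->
  lin3 T -> type12_21 I T -> type12_21 J T -> type12_21 K T ->
  x ^+ 2 + y ^+ 2 + z ^+ 2 = 1 -> type12_21 (x *: I + y *: J + z *: K) T.
Proof.
move=> tr lT tI tJ tK xyz u v w.
have oT := lin3_odd lT.
have d1 := fun u v w => lin1D (l31 lT v w) u; have d2' := fun u v w => lin1D (l32 lT u w) v.
have d3 := fun u v w => lin1D (l33 lT u v) w.
have z1 := fun a u v w => lin1Z (l31 lT v w) a u.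
have z2 := fun a u v w => lin1Z (l32 lT u w) a v.
have z3 := fun a u v w => lin1Z (l33 lT u v) a w.
rewrite !mulmxDl -!scalemxAl !(d1, d2', d3, z1, z2, z3).
have mIJ := type_mixed tr oT tI tJ tK u v w.
have mJK := type_mixed (quat_triple_rot tr) oT tJ tK tI u v w.
have mKI := type_mixed (quat_triple_rot (quat_triple_rot tr)) oT tK tI tJ u v w.
have hI := tI u v w; have hJ := tJ u v w; have hK := tK u v w.
rewrite -[LHS]mul1r -xyz !mulrDl {1}hI {1}hJ {1}hK.
apply/eqP; rewrite -subr_eq0; apply/eqP.
set a1 := (X in X = 0) in mIJ; set a2 := (X in X = 0) in mJK; set a3 := (X in X = 0) in mKI.
have : - (x * y * a1) - (y * z * a2) - (x * z * a3) = 0 by rewrite mIJ mJK mKI; ring.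
move=> <-; rewrite /a1 /a2 /a3; ring.
Qed.

(** * Smooth frames, traces and gradients *)

Section Frames.
Variables (R : realType) (m : nat) (M : manifold R m) (g : metric M).
Local Notation V := 'cV[R]_m.
Implicit Types (U W : set M) (p q : M) (X Y : M -> V) (f : M -> R^o).
Local Notation E i p := (coord_field p (std_basis R i)).

Lemma inner_metric p : inner (g p).
Proof. by split=> *; rewrite ?metricD ?metricZ //; exact: Defs.metric_sym. Qed.

Lemma smooth_det (k : nat) U (A : M -> 'M[R]_k) : open U ->
  (forall i j, smooth_fun U (fun q => A q i j : R^o)) ->
  smooth_fun U (fun q => \det (A q) : R^o).
Proof.
move=> oU sA; rewrite /determinant; apply: smooth_fun_sum => // s.
by apply: smooth_funZ => //; apply: smooth_fun_prod.
Qed.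

Lemma smooth_invmx (k : nat) U (A : M -> 'M[R]_k) : open U ->
  (forall q, U q -> A q \in unitmx) ->
  (forall i j, smooth_fun U (fun q => A q i j : R^o)) ->
  forall i j, smooth_fun U (fun q => invmx (A q) i j : R^o).
Proof.
move=> oU uA sA i j.
apply: (smooth_fun_eq oU (f := fun q => (\det (A q))^-1 * cofactor (A q) j i)).
  by move=> q Uq; rewrite /invmx uA // !mxE.
apply: smooth_funM => //.
  apply: smooth_funV => //; last exact: smooth_det.
  by move=> q /uA; rewrite unitmxE unitfE.
rewrite /cofactor; apply: smooth_funZ => //; apply: smooth_det => // a b.
apply: (smooth_fun_eq oU _ (sA (lift j a) (lift i b))) => q _; by rewrite !mxE.
Qed.

Lemma coord_field_eq0 p q u : chart_domain p q -> coord_field p u q = 0 -> u = 0.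
Proof.
move=> pq u0; have := field_in_coord u (chart_at_atlas p) pq pq.
by rewrite tchange_id // => <-; rewrite /field_in u0 /tchange derive0.
Qed.

Lemma coord_field_sum p q (c : V) : chart_domain p q ->
  \sum_i c i 0 *: E i p q = coord_field p c q.
Proof.
move=> pq; rewrite [in RHS](cV_decomp c) /coord_field tchange_sum //; try exact: chart_at_atlas.
  apply: eq_bigr => i _; rewrite tchangeZ //; try exact: chart_at_atlas.
  exact: chart_at_dom.
exact: chart_at_dom.
Qed.

Definition gram p q : 'M[R]_m := \matrix_(i, j) g q (E i p q) (E j p q).

(** A vector in the kernel of the Gram matrix is orthogonal to the whole frame,
    hence to itself. *)
Lemma gram_unit p q : chart_domain p q -> gram p q \in unitmx.
Proof.
move=> pq; rewrite -row_free_unit; apply: inj_row_free => x xG.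
have l2 := inner_lin2 (inner_metric q).
pose y := coord_field p x^T q.
have yE : y = \sum_i x 0 i *: E i p q.
  by rewrite /y -coord_field_sum //; apply: eq_bigr => i _; rewrite mxE.
have yj j : g q y (E j p q) = 0.
  have := congr1 (fun C : 'rV_m => C 0 j) xG; rewrite !mxE => <-.
  rewrite yE (lin1_sum (l2l l2 _)); apply: eq_bigr => i _.
  by rewrite (lin1Z (l2l l2 _)) mxE.
have y0 : y = 0.
  apply/eqP/negPn/negP => /(@metric_pos _ _ _ g q).
  rewrite {2}yE (lin1_sum (l2r l2 y)) big1 ?ltxx // => i _.
  by rewrite (lin1Z (l2r l2 y)) yj mulr0.
by have := coord_field_eq0 pq y0 => /(congr1 trmx); rewrite trmxK trmx0.
Qed.

Definition dual_frame p (j : 'I_m) (q : M) : V := \sum_i invmx (gram p q) j i *: E i p q.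

Lemma smooth_dual_frame p j : smooth_field (chart_domain p) (dual_frame p j).
Proof.
have oU := @open_chart_domain _ _ _ p; apply: smooth_field_sum => // i.
apply: smooth_fieldZ => //; last exact: smooth_coord_field.
apply: smooth_invmx => // [q|a b]; first exact: gram_unit.
apply: (smooth_fun_eq oU _ (metric_smooth g oU (smooth_coord_field p (std_basis R a))
  (smooth_coord_field p (std_basis R b)))) => q _.
by rewrite mxE.
Qed.

Lemma dual_frameP p q (X : V) : chart_domain p q ->
  X = \sum_j g q X (dual_frame p j q) *: E j p q.
Proof.
move=> pq; have l2 := inner_lin2 (inner_metric q).
pose x i : R := entry i (field_in (chart_at p) (fun=> X) q).
have XE : X = \sum_i x i *: E i p q by exact: (field_decomp (fun=> X) pq).
rewrite {1}XE; apply: eq_bigr => j _; congr (_ *: _).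
have -> : dual_frame p j q = \sum_i invmx (gram p q) j i *: E i p q by [].
rewrite (lin1_sum (l2r l2 X)).
have gX i : g q X (E i p q) = \sum_k x k * gram p q i k.
  rewrite {1}XE (lin1_sum (l2l l2 _)); apply: eq_bigr => k _.
  by rewrite (lin1Z (l2l l2 _)) mxE Defs.metric_sym.
under eq_bigr => i _.
  rewrite (lin1Z (l2r l2 X)) gX mulr_sumr.
  under eq_bigr => k _ do rewrite mulrCA.
  over.
rewrite exchange_big /=.
under eq_bigr => k _.
  rewrite -mulr_sumr.
  have -> : \sum_i invmx (gram p q) j i * gram p q i k = (j == k)%:R.
    have := mulVmx (gram_unit pq) => /(congr1 (fun A : 'M[R]_m => A j k)).
    by rewrite !mxE.
  over.
rewrite (bigD1 j) //= eqxx mulr1 big1 ?addr0 // => k kj.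
by rewrite eq_sym (negbTE kj) mulr0.
Qed.

Variable (e : M -> 'I_m -> V).
Hypothesis he : orthonormal_basis g e.

(** The orthonormal basis [e] need not vary smoothly, but the trace does not
    depend on it: near each point compute it in a coordinate frame and its dual. *)
Lemma smooth_trace U (b : M -> V -> V -> R) : open U ->
  (forall q, U q -> lin2 (b q)) ->
  (forall W X Y, open W -> W `<=` U -> smooth_field W X -> smooth_field W Y ->
    smooth_fun W (fun q => b q (X q) (Y q) : R^o)) ->
  smooth_fun U (fun q => \sum_i b q (e q i) (e q i) : R^o).
Proof.
move=> oU lb sb; apply: smooth_fun_locally => // q0 U0.
pose W := U `&` chart_domain q0.
have oW : open W by apply: openI => //; exact: open_chart_domain.
have WU : W `<=` U by move=> q [].
have Wc : W `<=` chart_domain q0 by move=> q [].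
exists W; split => //; first by split => //; exact: chart_at_dom.
apply: (smooth_fun_eq oW (f := fun q => \sum_j b q (E j q0 q) (dual_frame q0 j q))).
  move=> q [Uq cq]; symmetry.
  apply: (trace_dual (inner_metric q) (he q) (lb q Uq)) => X.
  exact: dual_frameP.
apply: smooth_fun_sum => // j; apply: sb => //; apply: (smooth_field_subset Wc).
  exact: smooth_coord_field.
exact: smooth_dual_frame.
Qed.

(** The gradient of [psi]: see [sharpP]. *)
Definition sharp p (psi : V -> R) : V := \sum_i psi (e p i) *: e p i.

Lemma sharpP p psi w : lin1 psi -> g p (sharp p psi) w = psi w.
Proof.
move=> l; have l2 := inner_lin2 (inner_metric p).
rewrite /sharp (lin1_sum (l2l l2 w)) -[RHS](trace_eval (inner_metric p) (he p) w l).
by apply: eq_bigr => i _; rewrite (lin1Z (l2l l2 w)).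
Qed.

Lemma smooth_sharp U (psi : M -> V -> R) : open U ->
  (forall q, U q -> lin1 (psi q)) ->
  (forall W X, open W -> W `<=` U -> smooth_field W X ->
    smooth_fun W (fun q => psi q (X q) : R^o)) ->
  smooth_field U (fun q => sharp q (psi q)).
Proof.
move=> oU lb sb; apply: smooth_field_locally => // q0 U0.
pose W := U `&` chart_domain q0.
have oW : open W by apply: openI => //; exact: open_chart_domain.
have WU : W `<=` U by move=> q [].
have Wc : W `<=` chart_domain q0 by move=> q [].
exists W; split => //; first by split => //; exact: chart_at_dom.
apply: (smooth_field_eq oW (X := fun q => \sum_j psi q (E j q0 q) *: dual_frame q0 j q)).
  move=> q [Uq cq]; apply: (@metric_inj _ _ _ g q) => w; have l := lb q Uq.
  have l2 := inner_lin2 (inner_metric q).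
  rewrite sharpP // (lin1_sum (l2l l2 w)) {2}(dual_frameP w cq) (lin1_sum l).
  apply: eq_bigr => j _; rewrite (lin1Z (l2l l2 w)) (lin1Z l) mulrC.
  by rewrite (Defs.metric_sym g q w).
apply: smooth_field_sum => // j; apply: smooth_fieldZ => //.
  by apply: sb => //; apply: (smooth_field_subset Wc); exact: smooth_coord_field.
by apply: (smooth_field_subset Wc); exact: smooth_dual_frame.
Qed.

End Frames.

(** * The candidate torsion of an admissible basis *)

Lemma ord3_cases (a : 'I_3) : [\/ a = 0, a = 1 | a = 2].
Proof.
by case: a => [[|[|[|]]] //= i]; [constructor 1|constructor 2|constructor 3]; apply/val_inj.
Qed.

Section Local.
Variables (R : realType) (m : nat) (M : manifold R m) (g : metric M).
Local Notation V := 'cV[R]_m.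
Variables (Q : M -> set 'M[R]_m) (hg : Q_hermitian g Q).
Variables (Dg : connection M) (hDg : levi_civita g Dg).
Variables (e : M -> 'I_m -> V) (he : orthonormal_basis g e).
Implicit Types (T : V -> V -> V -> R) (psi : V -> R).
Implicit Types (U W : set M) (p q : M) (X Y : M -> V) (J : 'I_3 -> M -> 'M[R]_m).

Lemma basis_in_Q U J q a : admissible_basis Q U J -> U q -> Q q (J a q).
Proof.
move=> [_ [_ H]] Uq; have [_ [_ [_ ->]]] := H q Uq.
exists (fun b => (b == a)%:R); rewrite (bigD1 a) //= eqxx scale1r big1 ?addr0 // => b ba.
by rewrite (negbTE ba) scale0r.
Qed.

Lemma basis_skew U J q a : admissible_basis Q U J -> U q ->
  forall u w, g q (J a q *m u) w = - g q u (J a q *m w).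
Proof.
move=> adm Uq u w; have [_ [_ H]] := adm; have [JJ _] := H q Uq.
rewrite -[in RHS](hg (basis_in_Q a adm Uq) (JJ a)) mulmxA JJ mulNmx mul1mx metricNr.
by rewrite opprK.
Qed.

Lemma basis_triple U J q a : admissible_basis Q U J -> U q ->
  quat_triple (g q) (J a q) (J (a + 1) q) (J (a + 2) q).
Proof.
move=> adm Uq; have [_ [_ H]] := adm; have [JJ [J01 [J10 _]]] := H q Uq.
have sq b (u : V) : J b q *m (J b q *m u) = - u by rewrite mulmxA JJ mulNmx mul1mx.
have e01 (u : V) : J 0 q *m (J 1 q *m u) = J 2 q *m u by rewrite mulmxA J01.
have e10 (u : V) : J 1 q *m (J 0 q *m u) = - (J 2 q *m u) by rewrite mulmxA J10 mulNmx.
have e02 (u : V) : J 0 q *m (J 2 q *m u) = - (J 1 q *m u) by rewrite -e01 sq.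
have e12 (u : V) : J 1 q *m (J 2 q *m u) = J 0 q *m u.
  by rewrite -[J 2 q *m u]opprK -e10 mulmxN sq opprK.
have e21 (u : V) : J 2 q *m (J 1 q *m u) = - (J 0 q *m u) by rewrite -e01 sq mulmxN.
have e20 (u : V) : J 2 q *m (J 0 q *m u) = J 1 q *m u.
  by rewrite -e01 e10 mulmxN e02 opprK.
have tr0 : quat_triple (g q) (J 0 q) (J 1 q) (J 2 q).
  by split=> //; [exact: inner_metric| | |]; exact: (basis_skew _ adm Uq).
case: (ord3_cases a) => ->.
- by rewrite !add0r.
- have -> : 1 + 1 = 2 :> 'I_3 by exact/val_inj.
  have -> : 1 + 2 = 0 :> 'I_3 by exact/val_inj.
  exact: quat_triple_rot tr0.
- have -> : 2 + 1 = 0 :> 'I_3 by exact/val_inj.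
  have -> : 2 + 2 = 1 :> 'I_3 by exact/val_inj.
  exact: quat_triple_rot (quat_triple_rot tr0).
Qed.

(** The covariant derivative of the Kaehler form of [J a] for the Levi-Civita
    connection, that is, [g(v, (Dg_u J_a) w)]. *)
Definition nablaF J a q u v w : R := g q v (endo_der Dg (J a) q u *m w).

Section Basis.
Variables (U : set M) (J : 'I_3 -> M -> 'M[R]_m) (adm : admissible_basis Q U J).
Let oU : open U := let: conj oU _ := adm in oU.
Let sJ a : smooth_endo U (J a) := let: conj _ (conj s _) := adm in s a.

Lemma nablaF_lin3 q a : U q -> lin3 (nablaF J a q).
Proof.
move=> Uq; have l2 := inner_lin2 (inner_metric g q); split => [v w|u w|u v] x y z; rewrite /nablaF.
- by rewrite (endo_der_linear Dg oU Uq (sJ a)) mulmxDl -scalemxAl (l2r l2).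
- by rewrite (l2l l2).
- by rewrite mulmxDr -scalemxAr (l2r l2).
Qed.

Lemma nablaF_skew q a : U q -> forall u v w, nablaF J a q u w v = - nablaF J a q u v w.
Proof.
move=> Uq u v w; rewrite /nablaF [in RHS]Defs.metric_sym.
rewrite (endo_der_skew u (hDg.1) oU Uq (sJ a)) ?opprK // => q' Uq' x y.
exact: (basis_skew a adm Uq').
Qed.

Lemma nablaF_anti q a : U q -> forall u v w,
  nablaF J a q u (J a q *m v) (J a q *m w) = - nablaF J a q u v w.
Proof.
move=> Uq u v w; rewrite /nablaF mulmxA (endo_der_sqr Dg u oU Uq (sJ a)); last first.
  by move=> q' Uq'; have [_ [_ H]] := adm; have [-> _] := H q' Uq'.
have t := basis_triple a adm Uq.
by rewrite mulNmx metricNr -mulmxA (tGI t) (tII t) metricNr opprK.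
Qed.

Lemma cov2_nablaF q a : U q -> cov2 Dg (kahler g J a) q = nablaF J a q.
Proof.
move=> Uq; apply/funext => u; apply/funext => v; apply/funext => w.
exact: (cov2_endo_form hDg.1 oU Uq (sJ a)).
Qed.

Lemma torsion3_Dg q u v w : torsion3 g Dg q u v w = 0.
Proof.
rewrite /torsion3 (hDg.2 (chart_domain q)) ?metric0 //; first exact: open_chart_domain.
- exact: chart_at_dom.
- exact: smooth_coord_field.
- exact: smooth_coord_field.
Qed.

Lemma d2_nablaF q a : U q -> d2 (kahler g J a) q = cyclic_sum (nablaF J a q).
Proof.
move=> Uq; apply/funext => u; apply/funext => v; apply/funext => w.
have := d2_endo_form hDg.1 oU Uq (sJ a) _ u v w.
rewrite !torsion3_Dg !addr0; apply => q' Uq'; exact: (basis_skew a adm Uq').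
Qed.

(** Both Lee forms only involve the Levi-Civita derivative of the Kaehler form
    at the point, so the algebra of quaternionic triples applies. *)
Lemma Kform_lee_K n q a : U q ->
  Kform g Dg e J n a q = lee_K (J a q) (J (a + 1) q) (J (a + 2) q) (e q) n (nablaF J a q).
Proof.
move=> Uq; apply/funext => u.
rewrite /Kform /lee_K /J1form /lee1 /codiff /lee2 /dkahler_plus /lee1_of /lee2_of.
by rewrite (cov2_nablaF a Uq) (d2_nablaF a Uq).
Qed.

Lemma qkt_torsionE n q a : U q -> qkt_torsion g Dg e J n a q = fun u v w =>
  part12_21 (J a q) (fun u v w => - cyclic_sum (nablaF J a q) (J a q *m u) (J a q *m v) (J a q *m w)) u v w
  - 2^-1 * (wedge12 (J1form (J a q) (Kform g Dg e J n a q)) (fun u v => g q u (J (a + 2) q *m v)) u v w +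
            wedge12 (Kform g Dg e J n a q) (fun u v => g q u (J (a + 1) q *m v)) u v w).
Proof.
move=> Uq; apply/funext => u; apply/funext => v; apply/funext => w.
by rewrite /qkt_torsion /d_sub_plus /d_sub (d2_nablaF a Uq).
Qed.

Lemma lin3_cyclic_sum T : lin3 T -> lin3 (cyclic_sum T).
Proof.
by move=> l; split => [v w|u w|u v] x y z; rewrite /cyclic_sum (l31 l) (l32 l) (l33 l); ring.
Qed.

Lemma lin3_part (A : 'M[R]_m) T : lin3 T -> lin3 (part12_21 A T).
Proof.
by move=> l; split => [v w|u w|u v] x y z;
  rewrite /part12_21 !mulmxDr -!scalemxAr !((l31 l), (l32 l), (l33 l)); ring.
Qed.

Lemma lin1_Kform n q a : U q -> lin1 (Kform g Dg e J n a q).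
Proof.
move=> Uq; rewrite Kform_lee_K //; have l := nablaF_lin3 a Uq.
have lp := lin3_part (J a q) (lin3_cyclic_sum l).
have l1 : lin1 (lee1_of (J a q) (e q) (nablaF J a q)).
  move=> x u v; rewrite /lee1_of mulmxDr -scalemxAr.
  under eq_bigr => i _ do rewrite (l33 l).
  by rewrite big_split /= -mulr_sumr; ring.
have l2 : lin1 (lee2_of (J a q) (J (a + 2) q) (e q) (nablaF J a q)).
  move=> x u v; rewrite /lee2_of.
  under eq_bigr => i _ do rewrite (l31 lp).
  by rewrite big_split /= -mulr_sumr; ring.
by move=> x u v; rewrite /lee_K /J1form mulmxDr -scalemxAr l1 l2; ring.
Qed.

Lemma lin3_wedge psi (A : 'M[R]_m) q : lin1 psi ->
  lin3 (wedge12 psi (fun u v => g q u (A *m v))).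
Proof.
move=> l; have l2 := inner_lin2 (inner_metric g q).
by split => [v w|u w|u v] x y z;
  rewrite /wedge12 l !mulmxDr -!scalemxAr !((l2r l2), (l2l l2)); ring.
Qed.

Lemma lin3_comb T1 T2 T3 : lin3 T1 -> lin3 T2 -> lin3 T3 ->
  lin3 (fun u v w => T1 u v w - 2^-1 * (T2 u v w + T3 u v w)).
Proof.
move=> l1 l2 l3; split => [v w|u w|u v] x y z.
- by rewrite (l31 l1) (l31 l2) (l31 l3); ring.
- by rewrite (l32 l1) (l32 l2) (l32 l3); ring.
- by rewrite (l33 l1) (l33 l2) (l33 l3); ring.
Qed.

Lemma lin3_neg T (A : 'M[R]_m) : lin3 T ->
  lin3 (fun u v w => - T (A *m u) (A *m v) (A *m w)).
Proof.
move=> l; split => [v w|u w|u v] x y z; rewrite mulmxDr -scalemxAr.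
- by rewrite (l31 l); ring.
- by rewrite (l32 l); ring.
- by rewrite (l33 l); ring.
Qed.

Lemma lin1_J1form psi (A : 'M[R]_m) : lin1 psi -> lin1 (J1form A psi).
Proof. by move=> l x u v; rewrite /J1form mulmxDr -scalemxAr l; ring. Qed.

Lemma qkt_torsion_lin3 n q a : U q -> lin3 (qkt_torsion g Dg e J n a q).
Proof.
move=> Uq; rewrite qkt_torsionE //; have lK := lin1_Kform n a Uq.
apply: lin3_comb; first exact/lin3_part/lin3_neg/lin3_cyclic_sum/nablaF_lin3.
- exact/lin3_wedge/lin1_J1form.
- exact: lin3_wedge.
Qed.

Lemma skew3_cyclic_sum T : (forall u v w, T u w v = - T u v w) -> skew3 (cyclic_sum T).
Proof.
move=> sE; split=> u v w; rewrite /cyclic_sum (sE u w v) (sE v u w) (sE w v u); ring.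
Qed.

Lemma skew3_part (A : 'M[R]_m) T : skew3 T -> skew3 (part12_21 A T).
Proof.
move=> s; split => u v w; rewrite /part12_21.
- rewrite (sk12 s u) (sk12 s (A *m u) (A *m v)) (sk12 s _ v) (sk12 s u (A *m v)); ring.
- rewrite (sk23 s u v) (sk23 s (A *m u) (A *m v)) (sk23 s _ v) (sk23 s u (A *m v)); ring.
Qed.

Lemma skew3_wedge psi (F : V -> V -> R) : (forall u w, F u w = - F w u) ->
  skew3 (wedge12 psi F).
Proof.
move=> sF; split => u v w; rewrite /wedge12 (sF w u) (sF v w) (sF u v); ring.
Qed.

Lemma skew3_comb T1 T2 T3 : skew3 T1 -> skew3 T2 -> skew3 T3 ->
  skew3 (fun u v w => T1 u v w - 2^-1 * (T2 u v w + T3 u v w)).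
Proof.
move=> s1 s2 s3; split => u v w.
- by rewrite (sk12 s1) (sk12 s2) (sk12 s3); ring.
- by rewrite (sk23 s1) (sk23 s2) (sk23 s3); ring.
Qed.

Lemma skew3_neg T (A : 'M[R]_m) : skew3 T ->
  skew3 (fun u v w => - T (A *m u) (A *m v) (A *m w)).
Proof. by move=> s; split => u v w; [rewrite (sk12 s)|rewrite (sk23 s)]. Qed.

Lemma qkt_torsion_skew3 n q a : U q -> skew3 (qkt_torsion g Dg e J n a q).
Proof.
move=> Uq; rewrite qkt_torsionE //.
have sF b u w : g q u (J b q *m w) = - g q w (J b q *m u).
  by rewrite Defs.metric_sym (basis_skew b adm Uq).
apply: skew3_comb; [|exact: skew3_wedge|exact: skew3_wedge].
apply/skew3_part/skew3_neg/skew3_cyclic_sum/(nablaF_skew a Uq).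
Qed.

Lemma qkt_torsion_type n q a : U q -> type12_21 (J a q) (qkt_torsion g Dg e J n a q).
Proof.
move=> Uq; rewrite qkt_torsionE //; apply: (torsion_formula_type (basis_triple a adm Uq)).
  exact/lin3_odd/lin3_neg/lin3_cyclic_sum/nablaF_lin3.
exact/lin1N/lin1_Kform.
Qed.

(** The condition for [a] is the difference of the torsion formulas for [a] and
    [a + 1]. *)
Lemma qkt_conditionE n q a : U q ->
  (qkt_condition g Dg e J n a q <->
   qkt_torsion g Dg e J n a q = qkt_torsion g Dg e J n (a + 1) q).
Proof.
move=> Uq; rewrite /qkt_condition.
have e2 : a + 1 + 1 = a + 2 by rewrite -addrA.
have e0 : a + 1 + 2 = a by rewrite -addrA (_ : 1 + 2 = 0) ?addr0 //; exact/val_inj.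
have tE u v w : (d_sub_plus g J a q u v w - d_sub_plus g J (a + 1) q u v w =
  2^-1 * (wedge12 (Kform g Dg e J n a q) (kahler g J (a + 1) q) u v w
    - wedge12 (J1form (J (a + 1) q) (Kform g Dg e J n (a + 1) q)) (kahler g J a q) u v w
    - wedge12 (fun x => Kform g Dg e J n (a + 1) q x - J1form (J a q) (Kform g Dg e J n a q) x)
        (kahler g J (a + 2) q) u v w)) <->
    qkt_torsion g Dg e J n a q u v w = qkt_torsion g Dg e J n (a + 1) q u v w.
  rewrite /qkt_torsion e2 e0.
  move: (d_sub_plus g J a q u v w) (d_sub_plus g J (a + 1) q u v w) => da db.
  move: (Kform g Dg e J n a q) (Kform g Dg e J n (a + 1) q) => Ka Kb.
  move: (kahler g J a q) (kahler g J (a + 1) q) (kahler g J (a + 2) q) => Fa Fb Fc.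
  by rewrite /wedge12; split => h; lra.
split=> [H|H u v w]; last by apply/tE; rewrite H.
apply/funext => u; apply/funext => v; apply/funext => w; exact/tE/H.
Qed.

End Basis.
End Local.

(** * Connections that preserve Q, at a point *)

Section Point.
Variables (R : realType) (m : nat) (M : manifold R m) (g : metric M).
Local Notation V := 'cV[R]_m.
Variables (Q : M -> set 'M[R]_m) (hg : Q_hermitian g Q).
Variables (Dg : connection M) (hDg : levi_civita g Dg).
Variables (e : M -> 'I_m -> V) (he : orthonormal_basis g e).
Hypothesis m0 : (0 < m)%N.
Implicit Types (T : V -> V -> V -> R) (psi : V -> R) (A : M -> 'M[R]_m).
Implicit Types (U W : set M) (p q : M) (X Y : M -> V) (J : 'I_3 -> M -> 'M[R]_m).

Let w0 : V := std_basis R (Ordinal m0).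
Lemma w0_neq0 : w0 != 0.
Proof.
apply/eqP => /(congr1 (fun v : V => v (Ordinal m0) 0)).
by rewrite !mxE !eqxx => /eqP; rewrite oner_eq0.
Qed.

Lemma w0_pos p : 0 < g p w0 w0.
Proof. exact: metric_pos w0_neq0. Qed.

Lemma sum_cyclic (W : zmodType) (F : 'I_3 -> W) a : \sum_b F b = F a + F (a + 1) + F (a + 2).
Proof.
rewrite !big_ord_recl big_ord0 addr0 /=.
have -> : lift ord0 ord0 = 1 :> 'I_3 by exact/val_inj.
have -> : lift ord0 (lift ord0 ord0) = 2 :> 'I_3 by exact/val_inj.
have -> : ord0 = 0 :> 'I_3 by exact/val_inj.
case: (ord3_cases a) => ->.
- by rewrite !add0r addrA.
- have -> : 1 + 1 = 2 :> 'I_3 by exact/val_inj.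
  have -> : 1 + 2 = 0 :> 'I_3 by exact/val_inj.
  by rewrite addrC.
- have -> : 2 + 1 = 0 :> 'I_3 by exact/val_inj.
  have -> : 2 + 2 = 1 :> 'I_3 by exact/val_inj.
  by rewrite addrA addrC addrA.
Qed.

Lemma Q_elem U J p C a : admissible_basis Q U J -> U p -> Q p C ->
  exists x y z, C = x *: J a p + y *: J (a + 1) p + z *: J (a + 2) p.
Proof.
move=> [_ [_ H]] Up; have [_ [_ [_ ->]]] := H p Up; move=> [x ->].
by exists (x a), (x (a + 1)), (x (a + 2)); rewrite (sum_cyclic _ a).
Qed.

Lemma Q_comb U J p (x : 'I_3 -> R) : admissible_basis Q U J -> U p ->
  Q p (\sum_a x a *: J a p).
Proof. by move=> [_ [_ H]] Up; have [_ [_ [_ ->]]] := H p Up; exists x. Qed.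

Lemma Q_comb2 U J p a (y z : R) : admissible_basis Q U J -> U p ->
  Q p (y *: J (a + 2) p + z *: J (a + 1) p).
Proof.
move=> adm Up.
have -> : y *: J (a + 2) p + z *: J (a + 1) p = \sum_b
   ((b == a + 2)%:R * y + (b == a + 1)%:R * z) *: J b p.
  rewrite (sum_cyclic _ a); case: (ord3_cases a) => -> /=;
  rewrite ?mul1r ?mul0r ?add0r ?addr0 ?scale0r ?add0r //; exact: addrC.
exact: Q_comb adm Up.
Qed.

Lemma Q_comb_mem U J p (x : 'I_3 -> R) (C : 'I_3 -> 'M[R]_m) : admissible_basis Q U J -> U p ->
  (forall a, Q p (C a)) -> Q p (\sum_a x a *: C a).
Proof.
move=> [_ [_ H]] Up; have [_ [_ [_ ->]]] := H p Up => HC.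
have [y yC] := choice HC.
exists (fun b => \sum_a x a * y a b).
under eq_bigr => a _ do rewrite yC scaler_sumr.
rewrite exchange_big /=; apply: eq_bigr => b _; rewrite scaler_suml.
by apply: eq_bigr => a _; rewrite scalerA.
Qed.

Lemma Q_add U J p C C' : admissible_basis Q U J -> U p -> Q p C -> Q p C' -> Q p (C + C').
Proof.
move=> [_ [_ H]] Up; have [_ [_ [_ ->]]] := H p Up; move=> [x ->] [y ->].
exists (fun b => x b + y b); rewrite -big_split /=.
by apply: eq_bigr => b _; rewrite scalerDl.
Qed.

Lemma Q_skew U J p C : admissible_basis Q U J -> U p -> Q p C ->
  forall u w, g p (C *m u) w = - g p u (C *m w).
Proof.
move=> adm Up QC u w; have [x [y [z ->]]] := Q_elem 0 adm Up QC.
rewrite !mulmxDl -!scalemxAl !(metricD, metricDr, metricZ, metricZr).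
rewrite !(basis_skew hg _ adm Up); ring.
Qed.

(** Anti-invariance rules out the component of [C] along [J a]. The
    coefficients are read off at a fixed nonzero vector, which makes them linear
    in [u]. *)
Lemma Q_valued_form U J p a (E : V -> V -> V -> R) : admissible_basis Q U J -> U p ->
  (forall v w, lin1 (fun u => E u v w)) ->
  (forall u v w, E u (J a p *m v) (J a p *m w) = - E u v w) ->
  (forall u, exists2 C, Q p C & forall v w, E u v w = g p v (C *m w)) ->
  exists y z, [/\ lin1 y, lin1 z & forall u v w, E u v w =
    y u * g p v (J (a + 2) p *m w) + z u * g p v (J (a + 1) p *m w)].
Proof.
move=> adm Up lE aE HC; have t := basis_triple hg a adm Up.
set I := J a p in t aE *; set JJ := J (a + 1) p in t *; set K := J (a + 2) p in t *.
have iG := triple_inner t; have w0p := w0_pos p; have w0n : g p w0 w0 != 0 by rewrite gt_eqF.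
have ort (B : 'M[R]_m) : (forall u v, g p (B *m u) v = - g p u (B *m v)) -> g p w0 (B *m w0) = 0.
  by move=> sk; have := sk w0 w0; rewrite innerC //; lra.
pose y u := E u (K *m w0) w0 / g p w0 w0; pose z u := E u (JJ *m w0) w0 / g p w0 w0.
have ly : lin1 y by move=> b u v; rewrite /y lE; ring.
have lz : lin1 z by move=> b u v; rewrite /z lE; ring.
exists y, z; split => // u v w.
have [C QC EC] := HC u.
have [x [x' [x'' CE]]] := Q_elem a adm Up QC.
have gC v' w' : E u v' w' = x * g p v' (I *m w') + x' * g p v' (JJ *m w') + x'' * g p v' (K *m w').
  by rewrite EC CE !mulmxDl -!scalemxAl !(metricDr, metricZr).
have x0 : x = 0.
  have h := aE u (I *m w0) w0; rewrite !gC !(quaternion_rules t) in h.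
  have oJ := ort _ (tGJ t); have oK := ort _ (tGK t).
  have : 2 * x * g p w0 w0 = 0 by rewrite ?oJ ?oK in h; lra.
  by move/eqP; rewrite !mulf_eq0 pnatr_eq0 /= (negbTE w0n) orbF => /eqP.
have -> : y u = x''.
  rewrite /y gC x0 !(quaternion_rules t) (ort _ (tGI t)).
  by field.
have -> : z u = x'.
  rewrite /z gC x0 !(quaternion_rules t) (ort _ (tGI t)).
  by field.
rewrite gC x0; ring.
Qed.

(** The connection [Dg + T/2] differentiates [A] into a section of [Q] at [p] in
    the direction [u]: pairing the commutator of [A] with the endomorphism
    [T(u, ., .)] gives the terms in [T]. No regularity of [T] is involved, so the
    notion makes sense before that connection is known to be smooth. *)
Definition preservesQ T p A u : Prop := exists2 C, Q p C & forall v w,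
  g p v (endo_der Dg A p u *m w) - 2^-1 * (T u v (A p *m w) + T u (A p *m v) w) =
  g p v (C *m w).

Lemma preservesQ_form U J p a T : admissible_basis Q U J -> U p -> lin3 T ->
  (forall u, preservesQ T p (J a) u) ->
  exists y z, [/\ lin1 y, lin1 z & forall u v w, nablaF g Dg J a p u v w =
    y u * g p v (J (a + 2) p *m w) + z u * g p v (J (a + 1) p *m w) +
    2^-1 * (T u v (J a p *m w) + T u (J a p *m v) w)].
Proof.
move=> adm Up lT HT; have t := basis_triple hg a adm Up; have oT := lin3_odd lT.
pose E u v w := nablaF g Dg J a p u v w - 2^-1 * (T u v (J a p *m w) + T u (J a p *m v) w).
have lEf := nablaF_lin3 g Dg adm a Up.
have lE v w : lin1 (fun u => E u v w).
  by move=> b x x'; rewrite /E (l31 lEf) !(l31 lT); ring.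
have aE u v w : E u (J a p *m v) (J a p *m w) = - E u v w.
  rewrite /E (nablaF_anti hg Dg adm a Up) !(tII t) !(od2 oT) !(od3 oT); ring.
have [y [z [ly lz Eyz]]] := Q_valued_form adm Up lE aE HT.
exists y, z; split => // u v w; rewrite -Eyz /E; ring.
Qed.

(** This holds for each admissible basis around [p], which makes the candidate
    torsions of different bases agree as soon as one of them satisfies the
    hypotheses for all. *)
Lemma torsion_determined n U J p a T : m = (4 * n)%N -> (1 < n)%N ->
  admissible_basis Q U J -> U p -> lin3 T -> skew3 T ->
  type12_21 (J a p) T -> type12_21 (J (a + 1) p) T ->
  (forall u, preservesQ T p (J a) u) -> T = qkt_torsion g Dg e J n a p.
Proof.
move=> mn n1 adm Up lT sT tT tT1 HT; have t := basis_triple hg a adm Up.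
have [y [z [ly lz Eyz]]] := preservesQ_form adm Up lT HT.
apply/funext => u; apply/funext => v; apply/funext => w.
rewrite (qkt_torsionE hg hDg e adm n a Up) (Kform_lee_K hg hDg e adm n a Up).
have -> : nablaF g Dg J a p = fun u v w => y u * g p v (J (a + 2) p *m w) +
    z u * g p v (J (a + 1) p *m w) + 2^-1 * (T u v (J a p *m w) + T u (J a p *m v) w).
  by apply/funext => u'; apply/funext => v'; apply/funext => w'; rewrite Eyz.
exact: (torsion_formula t (he p) lT sT tT tT1 ly lz mn n1).
Qed.

Lemma open_near p U : open U -> U p -> [/\ open (U `&` chart_domain p), (U `&` chart_domain p) p,
  U `&` chart_domain p `<=` U & U `&` chart_domain p `<=` chart_domain p].
Proof.
move=> oU Up; split; [apply: openI => //; exact: open_chart_domain|by split=> //; exact: chart_at_dom|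
 by move=> q []|by move=> q []].
Qed.

(** A section [A] of [Q] is a combination of an admissible basis; its
    coefficients are smooth, being the inner products of [A X] and [J_a X] divided by
    [g(X, X)] for a nowhere vanishing field [X], so the Leibniz rule applies. *)
Lemma preservesQ_transfer U J p T U0 A : admissible_basis Q U J -> U p -> lin3 T ->
  (forall a u, preservesQ T p (J a) u) -> open U0 -> U0 p -> smooth_endo U0 A ->
  (forall q, U0 q -> Q q (A q)) -> forall u, preservesQ T p A u.
Proof.
move=> adm Up lT HT oU0 U0p sA QA u.
have oU : open U by case: adm.
have sJ a : smooth_endo U (J a) by have [_ [s _]] := adm; exact: s.
have oT := lin3_odd lT.
have [oW Wp WU Wc] := open_near (openI oU oU0) (conj Up U0p).
set W := _ `&` _ in oW Wp WU Wc.
pose X := coord_field p w0.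
have Xp q : W q -> 0 < g q (X q) (X q).
  move=> Wq; apply: metric_pos; apply/eqP => X0.
  by have := w0_neq0; rewrite (coord_field_eq0 (Wc q Wq) X0) eqxx.
have sX : smooth_field W X by exact: smooth_coord_fieldS.
have sJW a : smooth_endo W (J a).
  by move=> W' Y oW' W'W sY; apply: sJ => // q /W'W/WU[].
have sAW : smooth_endo W A.
  by move=> W' Y oW' W'W sY; apply: sA => // q /W'W/WU[].
(* The structures [J a] are orthonormal in the sense that the vectors [J_a X] are. *)
pose x a q : R^o := g q (J a q *m X q) (A q *m X q) * (g q (X q) (X q))^-1.
have sx a : smooth_fun W (x a).
  apply: smooth_funM => //.
    exact: (metric_smooth g oW (sJW a W X oW (@subset_refl _ W) sX) (sAW W X oW (@subset_refl _ W) sX)).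
  apply: smooth_funV => //; last exact: metric_smooth.
  by move=> q Wq; rewrite gt_eqF // Xp.
have Ax q : W q -> A q = \sum_a x a q *: J a q.
  move=> Wq; have [Uq U0q] := WU q Wq.
  have t := basis_triple hg 0 adm Uq; have iG := triple_inner t.
  have [c [c' [c'' AE]]] := Q_elem 0 adm Uq (QA q U0q).
  have gn : g q (X q) (X q) != 0 by rewrite gt_eqF // Xp.
  have ort (B : 'M[R]_m) : (forall u v, g q (B *m u) v = - g q u (B *m v)) -> g q (X q) (B *m X q) = 0.
    by move=> sk; have := sk (X q) (X q); rewrite innerC //; lra.
  rewrite (sum_cyclic _ 0) {1}AE /x AE !mulmxDl -!scalemxAl !(metricDr, metricZr).
  rewrite !(quaternion_rules t) (ort _ (tGI t)) (ort _ (tGJ t)) (ort _ (tGK t)).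
  by congr (_ *: _ + _ *: _ + _ *: _); field.
have /choice[C HC] : forall a, exists C, Q p C /\ forall v w,
    g p v (endo_der Dg (J a) p u *m w) - 2^-1 * (T u v (J a p *m w) + T u (J a p *m v) w) =
    g p v (C *m w).
  by move=> a; have [C qC h] := HT a u; exists C.
exists (\sum_a x a p *: C a + \sum_a vder p u (x a) *: J a p).
  apply: (Q_add adm Up); last exact: Q_comb adm Up.
  by apply: (Q_comb_mem _ adm Up) => a; have [] := HC a.
move=> v w.
rewrite (endo_der_eq Dg u oW Wp sAW Ax) (endo_der_comb Dg u oW Wp sx sJW) (Ax p Wp).
have h0 := (HC 0).2 v w; have h1 := (HC 1).2 v w; have h2 := (HC 2).2 v w.
rewrite !(sum_cyclic _ 0) !add0r !mulmxDl -!scalemxAl !(metricDr, metricZr).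
rewrite -h0 -h1 -h2 {h0 h1 h2}.
rewrite !(lin1D (l33 lT u v)) !(lin1Z (l33 lT u v)) !(lin1D (l32 lT u w)) !(lin1Z (l32 lT u w)).
move: (x 0 p) (x 1 p) (x 2 p) (vder p u (x 0)) (vder p u (x 1)) (vder p u (x 2)).
move=> x0 x1 x2 y0 y1 y2; ring.
Qed.

(** Members of another admissible basis are unit combinations of the first. *)
Lemma type_transfer U J U' J' p T : admissible_basis Q U J -> U p ->
  admissible_basis Q U' J' -> U' p -> lin3 T ->
  (forall a, type12_21 (J a p) T) -> forall a, type12_21 (J' a p) T.
Proof.
move=> adm Up adm' Up' lT HT a; have t := basis_triple hg 0 adm Up; have iG := triple_inner t.
have [x [y [z JE]]] := Q_elem 0 adm Up (basis_in_Q a adm' Up').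
have w0p := w0_pos p; have w0n : g p w0 w0 != 0 by rewrite gt_eqF.
have ort (B : 'M[R]_m) : (forall u v, g p (B *m u) v = - g p u (B *m v)) -> g p w0 (B *m w0) = 0.
  by move=> sk; have := sk w0 w0; rewrite innerC //; lra.
have n1 : g p (J' a p *m w0) (J' a p *m w0) = g p w0 w0.
  have t' := basis_triple hg a adm' Up'.
  by rewrite (tGI t') (tII t') innerNr // opprK.
have n2 : g p (J' a p *m w0) (J' a p *m w0) = (x ^+ 2 + y ^+ 2 + z ^+ 2) * g p w0 w0.
  rewrite JE !mulmxDl -!scalemxAl !(metricD, metricDr, metricZ, metricZr).
  rewrite !(quaternion_rules t) (ort _ (tGI t)) (ort _ (tGJ t)) (ort _ (tGK t)); ring.
rewrite JE; apply: (type_comb t) => //.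
by apply: (mulIf w0n); rewrite -n2 n1 mul1r.
Qed.

(** The usual Koszul argument: the difference [s] of two metric connections is
    skew in its last two arguments, and its antisymmetrization in the first two is
    [T]; alternating the two symmetries three times gives [2 s = T]. *)
Lemma cov_diff_coord D p : metric_connection g D -> skew3 (torsion3 g D p) ->
  forall v u w, g p (D p v (coord_field p u)) w =
    g p (Dg p v (coord_field p u)) w + 2^-1 * torsion3 g D p v u w.
Proof.
move=> mD sT.
have oU := @open_chart_domain _ _ _ p; have Up := chart_at_dom p.
(* The Christoffel symbols of [D] and of [Dg] at [p]. *)
have [Gam GE] : exists Gam : V -> V -> V, forall x y, D p x (coord_field p y) = Gam x y.
  by eexists => x y; reflexivity.
have [Gg GgE] : exists Gg : V -> V -> V, forall x y, Dg p x (coord_field p y) = Gg x y.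
  by eexists => x y; reflexivity.
pose s v u w := g p (Gam v u) w - g p (Gg v u) w.
have ms v u w : s v u w = - s v w u.
  have h1 := mD _ _ _ p v oU Up (smooth_coord_field p u) (smooth_coord_field p w).
  have h2 := hDg.1 _ _ _ p v oU Up (smooth_coord_field p u) (smooth_coord_field p w).
  rewrite h1 !coord_field_self !GE !GgE in h2; rewrite /s.
  rewrite (Defs.metric_sym g p u (Gam v w)) (Defs.metric_sym g p u (Gg v w)) in h2.
  by move: (g p) h2 => G h2; lra.
have ts v u w : s v u w - s u v w = torsion3 g D p v u w.
  have := torsion3_Dg hDg p v u w.
  rewrite (torsion3E g Dg) (torsion3E g D) !GE !GgE /s.
  by move: (g p) => G h; lra.
move=> v u w; rewrite GE GgE.
have : 2 * s v u w = torsion3 g D p v u w.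
  have t1 := ts v u w; have t2 := ts u w v; have t3 := ts w v u.
  have r1 := rot3 sT v u w; have r2 := rot3 sT u w v.
  have m1 := ms v u w; have m2 := ms u w v; have m3 := ms w v u.
  move: (torsion3 g D p) t1 t2 t3 r1 r2 m1 m2 m3 => T *; lra.
by rewrite /s => <-; field.
Qed.

Lemma cov_diff D p U Y : metric_connection g D -> skew3 (torsion3 g D p) ->
  open U -> U p -> smooth_field U Y -> forall v w,
  g p (D p v Y) w = g p (Dg p v Y) w + 2^-1 * torsion3 g D p v (Y p) w.
Proof.
move=> mD sT oU Up sY v w.
rewrite (cov_decomp D v oU Up sY) (cov_decomp Dg v oU Up sY) !metricD.
by rewrite (cov_diff_coord mD sT) addrA.
Qed.

Lemma torsion3_lin3 D p : lin3 (torsion3 g D p).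
Proof.
have oU := @open_chart_domain _ _ _ p; have Up := chart_at_dom p.
have sE u := smooth_coord_field p u.
have [Gam GE] : exists Gam : V -> V -> V, forall x y, D p x (coord_field p y) = Gam x y.
  by eexists => x y; reflexivity.
have t u v w : torsion3 g D p u v w = g p (Gam u v) w - g p (Gam v u) w.
  by rewrite torsion3E !GE.
have l1 x y z v : Gam (x *: y + z) v = x *: Gam y v + Gam z v.
  by rewrite -!GE (cov_linear D x y z oU Up (sE v)).
have l2 x y z v : Gam v (x *: y + z) = x *: Gam v y + Gam v z.
  by rewrite -!GE; exact: cov_coord_linear.
split => [v w|u w|u v] x y z; rewrite !t.
- by rewrite l1 l2 !metricD !metricZ; ring.
- by rewrite l1 l2 !metricD !metricZ; ring.
- by rewrite !metricDr !metricZr; ring.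
Qed.

Lemma qkt_skew3 D p : qkt_connection g Q D -> skew3 (torsion3 g D p).
Proof. by move=> [_ [_ [s _]]]; split => u v w; have [] := s p u v w. Qed.

Lemma preservesQ_of_qkt U J p a D : qkt_connection g Q D -> admissible_basis Q U J -> U p ->
  forall u, preservesQ (torsion3 g D p) p (J a) u.
Proof.
move=> qD adm Up u; have [mD [quD _]] := qD; have sT := qkt_skew3 p qD.
have oU : open U by case: adm.
have sJ : smooth_endo U (J a) by have [_ [s _]] := adm; exact: s.
have [C QC HC] := quD U (J a) p u oU Up sJ (fun q => @basis_in_Q _ _ _ _ _ J q a adm).
have [oW Wp WU Wc] := open_near oU Up.
exists C => // v w.
have sE := smooth_coord_fieldS w Wc.
have sJE := sJ _ _ oW WU sE.
have h1 := HC _ _ oW Wp WU sE.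
have h2 := endo_derP Dg u oU sJ oW Wp WU sE.
rewrite coord_field_self in h1; rewrite coord_field_self in h2.
rewrite -h1 -h2 !metricDr !metricNr.
have sk := basis_skew hg a adm Up.
have skr x y : g p x (J a p *m y) = - g p (J a p *m x) y by rewrite sk opprK.
rewrite !skr ![g p v (_ p u _)]Defs.metric_sym ![g p (J a p *m v) (_ p u _)]Defs.metric_sym.
rewrite (cov_diff mD sT oW Wp sJE) (cov_diff mD sT oW Wp sE) coord_field_self.
rewrite (sk23 sT u v) (sk23 sT u (J a p *m v)); by field.
Qed.

(** Integrability enters here: the torsion-free quaternionic connection fixes
    the Nijenhuis tensor of [J a], and the candidate torsion fixes the
    (1,2)+(2,1) part of [dF], so [nablaF_of_torsion_formula] applies. No
    relation between the three candidate torsions of the basis is required. *)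
Lemma preservesQ_of_quaternionic n U J p a : quaternionic_manifold Q ->
  admissible_basis Q U J -> U p -> forall u, preservesQ (qkt_torsion g Dg e J n a p) p (J a) u.
Proof.
move=> [_ [D [tD quD]]] adm Up; have t := basis_triple hg a adm Up.
have oU : open U by case: adm.
have sJ : smooth_endo U (J a) by have [_ [s _]] := adm; exact: s.
have oc := @open_chart_domain _ _ _ p; have cp := chart_at_dom p.
have [oW Wp WU Wc] := open_near oU Up.
have sEc u := smooth_coord_field p u.
pose H u v w := g p v (D p u (coord_field p w)) - g p v (Dg p u (coord_field p w)).
have sym D' u w : torsion_free D' -> D' p u (coord_field p w) = D' p w (coord_field p u).
  move=> tD'; have := tD' _ _ _ p oc cp (sEc u) (sEc w).
  by rewrite torsion_coord => /eqP; rewrite subr_eq0 => /eqP.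
have Hs u v w : H u v w = H w v u by rewrite /H (sym _ u w tD) (sym _ u w hDg.2).
have lH v w : lin1 (fun u => H u v w).
  move=> x y z; rewrite /H (cov_linear D x y z oc cp (sEc w)) (cov_linear Dg x y z oc cp (sEc w)).
  rewrite !metricDr !metricZr; ring.
have oH : odd3 H.
  have o1 u v w : H (- u) v w = - H u v w by rewrite (lin1N (lH v w)).
  by split=> u v w //; [rewrite /H !metricN; ring|rewrite Hs o1 Hs].
pose E u v w := g p v (endo_der D (J a) p u *m w).
have EH u v w : nablaF g Dg J a p u v w + (H u v (J a p *m w) + H u (J a p *m v) w) = E u v w.
  have sE := smooth_coord_fieldS w Wc.
  have h1 := endo_derP D u oU sJ oW Wp WU sE.
  have h2 := endo_derP Dg u oU sJ oW Wp WU sE.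
  have sJE := sJ _ _ oW WU sE.
  rewrite coord_field_self in h1; rewrite coord_field_self in h2.
  rewrite /E /nablaF -h1 -h2.
  rewrite (cov_decomp D u oW Wp sJE) (cov_decomp Dg u oW Wp sJE) coord_field_self.
  rewrite /H !metricDr !metricNr !(tGI t); ring.
have aE u v w : E u (J a p *m v) (J a p *m w) = - E u v w.
  rewrite /E mulmxA (endo_der_sqr D u oU Up sJ); last first.
    by move=> q' Uq'; have [_ [_ HJ]] := adm; have [-> _] := HJ q' Uq'.
  by rewrite mulNmx metricNr -mulmxA (tGI t) (tII t) metricNr opprK.
have lE v w : lin1 (fun u => E u v w).
  move=> x y z; rewrite /E (endo_der_linear D oU Up sJ) mulmxDl -scalemxAl metricDr metricZr.
  by [].
have QE u : exists2 C, Q p C & forall v w, E u v w = g p v (C *m w).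
  have [C QC HC] := quD U (J a) p u oU Up sJ (fun q => @basis_in_Q _ _ _ _ _ J q a adm).
  exists C => // v w; have sE := smooth_coord_fieldS w Wc.
  have h1 := HC _ _ oW Wp WU sE; have h2 := endo_derP D u oU sJ oW Wp WU sE.
  by rewrite h2 coord_field_self in h1; rewrite /E h1.
have [yq [zq [lyq lzq Eyz]]] := Q_valued_form adm Up lE aE QE.
have lT := qkt_torsion_lin3 hg hDg e adm n a Up.
have sT := qkt_torsion_skew3 hg hDg e adm n a Up.
have TE := qkt_torsionE hg hDg e adm n a Up.
have lK := lin1_Kform hg hDg e adm n a Up.
have RH u v w : nablaF g Dg J a p u v w + (H u v (J a p *m w) + H u (J a p *m v) w) =
   yq u * g p v (J (a + 2) p *m w) + zq u * g p v (J (a + 1) p *m w) by rewrite EH Eyz.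
have TE' u v w := congr1 (fun f => f u v w) TE.
have [y [z [ly lz Efy]]] := nablaF_of_torsion_formula t (nablaF_lin3 g Dg adm a Up) (nablaF_skew hg hDg adm a Up)
  (nablaF_anti hg Dg adm a Up) (lin3_odd lT) sT lK lyq lzq oH Hs RH TE'.
move=> u; exists (y u *: J (a + 2) p + z u *: J (a + 1) p); first exact: Q_comb2 adm Up.
move=> v w; have := Efy u v w; rewrite /nablaF => ->.
rewrite mulmxDl -!scalemxAl metricDr !metricZr; ring.
Qed.

End Point.

(** * Smoothness of the candidate torsion and the shifted connection *)

Section SmoothTensors.
Variables (R : realType) (m : nat) (M : manifold R m).
Local Notation V := 'cV[R]_m.
Implicit Types (U W : set M) (t : M -> V -> V -> V -> R) (psi : M -> V -> R).
Implicit Types (A : M -> 'M[R]_m).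

Definition smooth1 U psi := forall W (X : M -> V), open W -> W `<=` U ->
  smooth_field W X -> smooth_fun W (fun q => psi q (X q) : R^o).

Definition smooth3 U t := forall W (X Y Z : M -> V), open W -> W `<=` U ->
  smooth_field W X -> smooth_field W Y -> smooth_field W Z ->
  smooth_fun W (fun q => t q (X q) (Y q) (Z q) : R^o).

Lemma smooth3_cyclic_sum U t : smooth3 U t -> smooth3 U (fun q => cyclic_sum (t q)).
Proof.
move=> st W X Y Z oW WU sX sY sZ.
by apply: smooth_funD => //; [apply: smooth_funD => //|]; exact: st.
Qed.

Lemma smooth3_part U t A : smooth_endo U A -> smooth3 U t ->
  smooth3 U (fun q => part12_21 (A q) (t q)).
Proof.
move=> sA st W X Y Z oW WU sX sY sZ.
have sAX := sA W X oW WU sX; have sAY := sA W Y oW WU sY; have sAZ := sA W Z oW WU sZ.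
apply: smooth_funZ => //; do 3 ?[apply: smooth_funD => //].
- by apply: smooth_funZ => //; exact: st.
- exact: (st W _ _ _ oW WU sAX sAY sZ).
- exact: (st W _ _ _ oW WU sAX sY sAZ).
- exact: (st W _ _ _ oW WU sX sAY sAZ).
Qed.

Lemma smooth3_neg U t A : smooth_endo U A -> smooth3 U t ->
  smooth3 U (fun q u v w => - t q (A q *m u) (A q *m v) (A q *m w)).
Proof.
move=> sA st W X Y Z oW WU sX sY sZ.
have sAX := sA W X oW WU sX; have sAY := sA W Y oW WU sY; have sAZ := sA W Z oW WU sZ.
apply: smooth_funN => //; exact: (st W _ _ _ oW WU sAX sAY sAZ).
Qed.

Lemma smooth1_J1form U psi A : smooth_endo U A -> smooth1 U psi ->
  smooth1 U (fun q => J1form (A q) (psi q)).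
Proof.
move=> sA s W X oW WU sX; apply: smooth_funN => //.
exact: (s W _ oW WU (sA W X oW WU sX)).
Qed.

Lemma smooth3_wedge U psi A (g : metric M) : smooth_endo U A -> smooth1 U psi ->
  smooth3 U (fun q => wedge12 (psi q) (fun u v => g q u (A q *m v))).
Proof.
move=> sA s W X Y Z oW WU sX sY sZ.
have sAX := sA W X oW WU sX; have sAY := sA W Y oW WU sY; have sAZ := sA W Z oW WU sZ.
have sX1 := s W X oW WU sX; have sY1 := s W Y oW WU sY; have sZ1 := s W Z oW WU sZ.
have g1 := smooth_funM oW sX1 (metric_smooth g oW sY sAZ).
have g2 := smooth_funM oW sY1 (metric_smooth g oW sZ sAX).
have g3 := smooth_funM oW sZ1 (metric_smooth g oW sX sAY).
exact: (smooth_funD oW (smooth_funD oW g1 g2) g3).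
Qed.

Lemma smooth3_comb U t1 t2 t3 : smooth3 U t1 -> smooth3 U t2 -> smooth3 U t3 ->
  smooth3 U (fun q u v w => t1 q u v w - 2^-1 * (t2 q u v w + t3 q u v w)).
Proof.
move=> s1 s2 s3 W X Y Z oW WU sX sY sZ.
have h1 := s1 W X Y Z oW WU sX sY sZ; have h2 := s2 W X Y Z oW WU sX sY sZ.
have h3 := s3 W X Y Z oW WU sX sY sZ.
exact: (smooth_funB oW h1 (smooth_funZ 2^-1 oW (smooth_funD oW h2 h3))).
Qed.

End SmoothTensors.

Section SmoothTorsion.
Variables (R : realType) (m : nat) (M : manifold R m) (g : metric M).
Local Notation V := 'cV[R]_m.
Variables (Q : M -> set 'M[R]_m) (hg : Q_hermitian g Q).
Variables (Dg : connection M) (hDg : levi_civita g Dg).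
Variables (e : M -> 'I_m -> V) (he : orthonormal_basis g e).
Variables (U : set M) (J : 'I_3 -> M -> 'M[R]_m) (adm : admissible_basis Q U J).
Let oU : open U := let: conj oU _ := adm in oU.
Let sJ a : smooth_endo U (J a) := let: conj _ (conj s _) := adm in s a.

(** The derivative of [J a] along smooth fields is expressed by the connection
    applied to the smooth fields [Z] and [J_a Z]. *)
Lemma smooth_nablaF a : smooth3 U (nablaF g Dg J a).
Proof.
move=> W X Y Z oW WU sX sY sZ.
have sJZ := sJ a oW WU sZ.
have sD := smooth_fieldB oW (cov_smooth Dg oW sX sJZ)
  (sJ a oW WU (cov_smooth Dg oW sX sZ)).
apply: (smooth_fun_eq oW _ (metric_smooth g oW sY sD)) => q Wq.
by rewrite /nablaF -(endo_derP Dg (X q) oU (sJ a) oW Wq WU sZ).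
Qed.

Lemma smooth_Kform n a : smooth1 U (fun q => Kform g Dg e J n a q).
Proof.
move=> W X oW WU sX.
have sF := smooth_nablaF a; have sP := smooth3_part (sJ a) (smooth3_cyclic_sum sF).
have lE q (Wq : W q) := nablaF_lin3 g Dg adm a (WU q Wq).
have lP q (Wq : W q) := lin3_part (J a q) (lin3_cyclic_sum (lE q Wq)).
have sl1 : smooth_fun W (fun q => J1form (J (a + 1) q) (lee1_of (J a q) (e q) (nablaF g Dg J a q)) (X q) : R^o).
  apply: smooth_funN => //; apply: smooth_funN => //.
  pose Y q := J a q *m (J (a + 1) q *m X q).
  have sY : smooth_field W Y by exact (sJ a oW WU (sJ (a + 1) oW WU sX)).
  apply: (smooth_trace he (b := fun q u v => nablaF g Dg J a q u v (Y q))) => //.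
    by move=> q Wq; split=> *; [exact: (l31 (lE q Wq))|exact: (l32 (lE q Wq))].
  move=> W' X' Y' oW' W'W sX' sY'.
  exact (sF W' X' Y' Y oW' (subset_trans W'W WU) sX' sY' (smooth_field_subset W'W sY)).
have sl2 : smooth_fun W (fun q => lee2_of (J a q) (J (a + 2) q) (e q) (nablaF g Dg J a q) (X q) : R^o).
  apply: smooth_funZ => //.
  apply: (smooth_trace he (b := fun q u v =>
    part12_21 (J a q) (cyclic_sum (nablaF g Dg J a q)) (X q) u (J (a + 2) q *m v))) => //.
    move=> q Wq; split=> [v x y z|u]; first exact: (l32 (lP q Wq)).
    exact (lin1_mulmx (J (a + 2) q) (l33 (lP q Wq) (X q) u)).
  move=> W' X' Y' oW' W'W sX' sY'; have W'U := subset_trans W'W WU.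
  exact (sP W' X X' (fun q => J (a + 2) q *m Y' q) oW' W'U (smooth_field_subset W'W sX) sX'
    (sJ (a + 2) oW' W'U sY')).
apply: (smooth_fun_eq oW _ (smooth_funZ (1 - n%:R)^-1 oW (smooth_funD oW sl1 sl2))) => q Wq.
by rewrite (Kform_lee_K hg hDg e adm n a (WU q Wq)).
Qed.

Lemma smooth_qkt_torsion n a : smooth3 U (fun q => qkt_torsion g Dg e J n a q).
Proof.
move=> W X Y Z oW WU sX sY sZ.
have sK := smooth_Kform n a.
have s1 := smooth3_part (sJ a) (smooth3_neg (sJ a) (smooth3_cyclic_sum (smooth_nablaF a))).
have s2 := smooth3_wedge g (sJ (a + 2)) (smooth1_J1form (sJ a) sK).
have s3 := smooth3_wedge g (sJ (a + 1)) sK.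
have s := smooth3_comb s1 s2 s3.
apply: (smooth_fun_eq oW _ (s W X Y Z oW WU sX sY sZ)) => q Wq.
by rewrite (qkt_torsionE hg hDg e adm n a (WU q Wq)).
Qed.

End SmoothTorsion.

Section ShiftedConnection.
Variables (R : realType) (m : nat) (M : manifold R m) (g : metric M).
Local Notation V := 'cV[R]_m.
Variables (D : connection M) (e : M -> 'I_m -> V) (he : orthonormal_basis g e).
Variable (T : M -> V -> V -> V -> R).
Hypotheses (lT : forall p, lin3 (T p)) (sT : smooth3 setT T).

(** The connection [D + T/2], with the last index of [T] raised by [g]. *)
Definition shift_cov (p : M) (v : V) (Y : M -> V) : V :=
  D p v Y + 2^-1 *: sharp e p (T p v (Y p)).

Lemma shift_covE p v Y w : g p (shift_cov p v Y) w = g p (D p v Y) w + 2^-1 * T p v (Y p) w.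
Proof. by rewrite /shift_cov metricD metricZ (sharpP he p w (l33 (lT p) v (Y p))). Qed.

Lemma shift_local (U : set M) X Y p v : open U -> U p -> smooth_field U X ->
    (forall q, U q -> X q = Y q) -> shift_cov p v X = shift_cov p v Y.
Proof.
by move=> oU Up sX XY; rewrite /shift_cov (cov_local D v oU Up sX XY) XY.
Qed.

Lemma shift_linear (U : set M) X p (a : R) u v : open U -> U p -> smooth_field U X ->
  shift_cov p (a *: u + v) X = a *: shift_cov p u X + shift_cov p v X.
Proof.
move=> oU Up sX; apply: (@metric_inj _ _ _ g p) => w.
rewrite [RHS]metricD metricZ !shift_covE (cov_linear D a u v oU Up sX) metricD metricZ.
rewrite (l31 (lT p)); ring.
Qed.

Lemma shift_add (U : set M) X Y p v : open U -> U p ->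
    smooth_field U X -> smooth_field U Y ->
  shift_cov p v (fun q => X q + Y q) = shift_cov p v X + shift_cov p v Y.
Proof.
move=> oU Up sX sY; apply: (@metric_inj _ _ _ g p) => w.
rewrite [RHS]metricD !shift_covE (cov_add D v oU Up sX sY) metricD.
rewrite (lin1D (l32 (lT p) v w)); ring.
Qed.

Lemma shift_leibniz (U : set M) (f : M -> R^o) X p v : open U -> U p ->
    smooth_fun U f -> smooth_field U X ->
  shift_cov p v (fun q => f q *: X q) = f p *: shift_cov p v X + vder p v f *: X p.
Proof.
move=> oU Up sf sX; apply: (@metric_inj _ _ _ g p) => w.
rewrite [RHS]metricD !metricZ !shift_covE (cov_leibniz D v oU Up sf sX) metricD !metricZ.
rewrite (lin1Z (l32 (lT p) v w)); ring.
Qed.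

Lemma shift_smooth (U : set M) X Y : open U -> smooth_field U X -> smooth_field U Y ->
  smooth_field U (fun q => shift_cov q (X q) Y).
Proof.
move=> oU sX sY.
have ss : smooth_field U (fun q => sharp e q (T q (X q) (Y q))).
  apply: (smooth_sharp he (psi := fun q => T q (X q) (Y q)) oU).
    by move=> q _; exact: (l33 (lT q)).
  move=> W Z oW WU sZ.
  exact (sT oW (@subsetT _ W) (smooth_field_subset WU sX) (smooth_field_subset WU sY) sZ).
exact: (smooth_fieldD oU (cov_smooth D oU sX sY) (smooth_fieldZ oU (smooth_fun_cst U 2^-1) ss)).
Qed.

Definition shift_connection : connection M :=
  @Connection _ _ M shift_cov shift_local shift_linear shift_add shift_leibniz shift_smooth.

Hypothesis skT : forall p, skew3 (T p).

Lemma shift_metric : metric_connection g D -> metric_connection g shift_connection.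
Proof.
move=> mD U X Y p v oU Up sX sY; rewrite (mD U X Y p v oU Up sX sY) /=.
rewrite (Defs.metric_sym g p (X p) (shift_cov _ _ _)) !shift_covE.
rewrite (Defs.metric_sym g p (X p)) (sk23 (skT p) v (Y p)); ring.
Qed.

Lemma shift_torsion3 p : torsion_free D -> torsion3 g shift_connection p = T p.
Proof.
move=> tD; apply/funext => u; apply/funext => v; apply/funext => w.
have h x y : g p (shift_connection p x (coord_field p y)) w =
    g p (D p x (coord_field p y)) w + 2^-1 * T p x y w.
  by have := shift_covE p x (coord_field p y) w; rewrite coord_field_self.
have e0 : D p u (coord_field p v) = D p v (coord_field p u).
  have := tD _ _ _ p (@open_chart_domain _ _ _ p) (chart_at_dom p)
    (smooth_coord_field p u) (smooth_coord_field p v).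
  by rewrite torsion_coord => /eqP; rewrite subr_eq0 => /eqP.
apply: (etrans (torsion3E g shift_connection p u v w)).
apply: (etrans (congr2 (fun a b : R => a - b) (h u v) (h v u))).
rewrite e0 (sk12 (skT p) v u).
by move: (g p _ w) => x; field.
Qed.

End ShiftedConnection.

(** * Existence and uniqueness of the QKT connection *)

Section QKT.
Variables (R : realType) (m n : nat) (M : manifold R m) (g : metric M).
Local Notation V := 'cV[R]_m.
Hypotheses (mn : m = (4 * n)%N) (n1 : (1 < n)%N).
Variables (Q : M -> set 'M[R]_m) (hg : Q_hermitian g Q).
Variables (Dg : connection M) (hDg : levi_civita g Dg).
Variables (e : M -> 'I_m -> V) (he : orthonormal_basis g e).
Implicit Types (U : set M) (p : M) (J : 'I_3 -> M -> 'M[R]_m) (D : connection M).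

Lemma dim_gt0 : (0 < m)%N.
Proof. by rewrite mn muln_gt0 (ltn_trans _ n1). Qed.

Lemma qkt_torsion_eq U J p a D : qkt_connection g Q D -> admissible_basis Q U J -> U p ->
  torsion3 g D p = qkt_torsion g Dg e J n a p.
Proof.
move=> qD adm Up; have [_ [_ [_ tyD]]] := qD.
apply: (torsion_determined hg hDg he dim_gt0 mn n1 adm Up).
- exact: torsion3_lin3.
- exact: qkt_skew3 qD.
- exact: tyD adm p a Up.
- exact: tyD adm p (a + 1) Up.
- exact: (preservesQ_of_qkt hg hDg a qD adm Up).
Qed.

Section Existence.
Hypothesis hQ : quaternionic_manifold Q.
Variable B : set (set M * ('I_3 -> M -> 'M[R]_m)).
Hypothesis hB : forall b, B b -> admissible_basis Q b.1 b.2.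
Hypothesis Bcover : forall p, exists2 b, B b & b.1 p.
Hypothesis cond : forall b, B b -> forall p a, b.1 p -> qkt_condition g Dg e b.2 n a p.

(** At each point take the candidate torsion of a chosen basis of the family.
    The conditions make it independent of the index, hence of type (1,2)+(2,1)
    for all three structures, and its connection preserves [Q]. Both facts pass to
    any other admissible basis around the point, where [torsion_determined]
    identifies it with the candidate torsion of that basis. *)
Lemma torsion_exists : exists T : M -> V -> V -> V -> R,
  forall U J, admissible_basis Q U J -> forall p, U p ->
    (forall a, T p = qkt_torsion g Dg e J n a p) /\
    (forall a u, preservesQ g Q Dg (T p) p (J a) u).
Proof.
have /choice[bs bsP] : forall p, exists b, B b /\ b.1 p.
  by move=> p; have [b Bb bp] := Bcover p; exists b.
exists (fun p => qkt_torsion g Dg e (bs p).2 n 0 p) => U J adm p Up.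
set T := qkt_torsion _ _ _ _ _ _ _.
have [Bb bp] := bsP p; have admb := hB Bb; set J0 := (bs p).2 in T admb *.
have T_a a : T = qkt_torsion g Dg e J0 n a p.
  have step b : qkt_torsion g Dg e J0 n b p = qkt_torsion g Dg e J0 n (b + 1) p.
    exact/(qkt_conditionE g Dg e J0 n b bp)/(cond Bb b bp).
  have s0 := step 0; have s1 := step 1; rewrite add0r in s0.
  by case: (ord3_cases a) => ->; rewrite /T ?s0 // s1.
have lT : lin3 T by exact: (qkt_torsion_lin3 hg hDg e admb n 0 bp).
have sT : skew3 T by exact: (qkt_torsion_skew3 hg hDg e admb n 0 bp).
have tyT a : type12_21 (J0 a p) T.
  by rewrite (T_a a); exact: (qkt_torsion_type hg hDg e admb n a bp).
have pT a u : preservesQ g Q Dg T p (J0 a) u.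
  by rewrite (T_a a); exact: (preservesQ_of_quaternionic hg hDg e dim_gt0 n a hQ admb bp).
have oU : open U by case: adm.
have sJ a : smooth_endo U (J a) by have [_ [s _]] := adm; exact: s.
have pTJ a u : preservesQ g Q Dg T p (J a) u.
  apply: (preservesQ_transfer hg dim_gt0 admb bp lT pT oU Up (sJ a)) => q Uq.
  exact: (basis_in_Q a adm Uq).
have tyJ := type_transfer hg dim_gt0 admb bp adm Up lT tyT.
split=> // a; exact: (torsion_determined hg hDg he dim_gt0 mn n1 adm Up lT sT (tyJ a) (tyJ (a + 1)) (pTJ a)).
Qed.

(** The torsion of [torsion_exists] is smooth because near each point it is the
    candidate torsion of a single admissible basis. *)
Lemma qkt_exists : qkt_manifold g Q.
Proof.
have [T HT] := torsion_exists.
have basis p : exists U J, [/\ admissible_basis Q U J & U p].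
  by have [b Bb bp] := Bcover p; exists b.1, b.2; split => //; exact: hB.
have lT p : lin3 (T p).
  have [U [J [adm Up]]] := basis p; have [/(_ 0) -> _] := HT U J adm p Up.
  exact: (qkt_torsion_lin3 hg hDg e adm n 0 Up).
have sT p : skew3 (T p).
  have [U [J [adm Up]]] := basis p; have [/(_ 0) -> _] := HT U J adm p Up.
  exact: (qkt_torsion_skew3 hg hDg e adm n 0 Up).
have smT : smooth3 setT T.
  move=> W X Y Z oW _ sX sY sZ; apply: smooth_fun_locally => // p Wp.
  have [U [J [adm Up]]] := basis p; have oU : open U by case: adm.
  pose W' := W `&` U; have oW' : open W' by exact: openI.
  have W'W : W' `<=` W by move=> q [].
  have W'U : W' `<=` U by move=> q [].
  exists W'; split => //.
  have s := smooth_qkt_torsion hg hDg he adm n 0 oW' W'U (smooth_field_subset W'W sX)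
    (smooth_field_subset W'W sY) (smooth_field_subset W'W sZ).
  apply: (smooth_fun_eq oW' _ s) => q [_ Uq]; by have [/(_ 0) -> _] := HT U J adm q Uq.
pose D := shift_connection Dg he lT smT.
have tD p : torsion3 g D p = T p by exact: (shift_torsion3 he lT smT sT p hDg.2).
exists D; split; [|split; [|split]].
- exact: (shift_metric he lT smT sT hDg.1).
- move=> U A p v oU Up sA QA.
  have [U' [J [adm Up']]] := basis p; have [_ pT] := HT U' J adm p Up'.
  have [C QC HC] := preservesQ_transfer hg dim_gt0 adm Up' (lT p) pT oU Up sA QA v.
  exists C => // W Y oW Wp WU sY; apply: (@metric_inj _ _ _ g p) => w.
  have sk := Q_skew hg adm Up' (QA p Up).
  have h1 : g p (D p v (fun q => A q *m Y q)) w = _ := shift_covE Dg he lT p v (fun q => A q *m Y q) w.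
  have h2 : g p (D p v Y) (A p *m w) = _ := shift_covE Dg he lT p v Y (A p *m w).
  have h3 := HC w (Y p); rewrite -(endo_derP Dg v oU sA oW Wp WU sY) in h3.
  rewrite metricDr metricNr in h3.
  rewrite (Defs.metric_sym g p _ w) metricDr metricNr.
  rewrite [g p w (D p v _)]Defs.metric_sym h1.
  have -> : g p w (A p *m D p v Y) = - g p (D p v Y) (A p *m w).
    by rewrite Defs.metric_sym sk.
  rewrite h2 (Defs.metric_sym g p (C *m Y p)) -h3.
  have -> : g p w (A p *m Dg p v Y) = - g p (Dg p v Y) (A p *m w).
    by rewrite Defs.metric_sym sk.
  rewrite (Defs.metric_sym g p w (Dg p v _)) (sk23 (sT p) v w) (sk23 (sT p) v (A p *m w)).
  ring.
- by move=> p u v w; rewrite tD; split; [exact: (sk12 (sT p))|exact: (sk23 (sT p))].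
- move=> U J adm p a Up; rewrite tD; have [/(_ a) -> _] := HT U J adm p Up.
  exact: (qkt_torsion_type hg hDg e adm n a Up).
Qed.

End Existence.

Lemma qkt_skew_shift D p U J a : qkt_connection g Q D -> admissible_basis Q U J -> U p ->
  skew_shift g Dg D p (qkt_torsion g Dg e J n a p).
Proof.
move=> qD adm Up W Y v w oW Wp sY; rewrite -(qkt_torsion_eq a qD adm Up).
have [mD _] := qD; exact: (cov_diff hDg mD (qkt_skew3 p qD) oW Wp sY).
Qed.

Lemma qkt_unique D D' : almost_quaternionic Q ->
  qkt_connection g Q D -> qkt_connection g Q D' -> connection_eq D' D.
Proof.
move=> aQ qD qD' W Y p v oW Wp sY; have [U [J [Up adm]]] := aQ p.
apply: (@metric_inj _ _ _ g p) => w.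
by rewrite (qkt_skew_shift 0 qD adm Up v w oW Wp sY) (qkt_skew_shift 0 qD' adm Up v w oW Wp sY).
Qed.

End QKT.

Theorem theorem2p2 (R : realType) (n : nat) (n_gt1 : (1 < n)%N)
    (M : manifold R (4 * n)%N) (g : metric M) (Q : M -> set 'M[R]_(4 * n))
    (hQ : quaternionic_manifold Q) (hg : Q_hermitian g Q)
    (Dg : connection M) (hDg : levi_civita g Dg)
    (e : M -> 'I_(4 * n) -> 'cV[R]_(4 * n)) (he : orthonormal_basis g e)
    (* a family of local admissible bases (U, J) of Q whose domains cover M *)
    (B : set (set M * ('I_3 -> M -> 'M[R]_(4 * n))))
    (hB : forall b, B b -> admissible_basis Q b.1 b.2)
    (Bcover : forall p, exists2 b, B b & b.1 p) :
  (qkt_manifold g Q <->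
   forall b, B b -> forall (p : M) (a : 'I_3), b.1 p ->
     qkt_condition g Dg e b.2 n a p) /\
  (qkt_manifold g Q ->
   exists D : connection M,
     qkt_connection g Q D /\
     (forall D' : connection M, qkt_connection g Q D' -> connection_eq D' D) /\
     (forall U J, admissible_basis Q U J ->
        forall (p : M) (a : 'I_3), U p ->
          skew_shift g Dg D p (qkt_torsion g Dg e J n a p))).
Proof.
have mn : (4 * n)%N = (4 * n)%N by [].
split; last first.
  move=> [D qD]; exists D; split=> //; split.
    by move=> D' qD'; exact: (qkt_unique mn n_gt1 hg hDg he hQ.1 qD qD').
  by move=> U J adm p a Up; exact: (qkt_skew_shift mn n_gt1 hg hDg he a qD adm Up).
split=> [[D qD] b Bb p a bp|cond].
  apply/(qkt_conditionE g Dg e b.2 n a bp).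
  rewrite -(qkt_torsion_eq mn n_gt1 hg hDg he a qD (hB b Bb) bp).
  exact: (qkt_torsion_eq mn n_gt1 hg hDg he (a + 1) qD (hB b Bb) bp).
exact: (qkt_exists mn n_gt1 hg hDg he hQ hB Bcover cond).
Qed.
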